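(* Let $(u_n^{\varepsilon},p_n^{\varepsilon})_{n\ge 0}$ satisfy the standard variable-step artificial compression method: for all $n\ge 0$, $$\frac{u_{n+1}^{\varepsilon}-u_n^{\varepsilon}}{k_{n+1}}+\nabla p_{n+1}^{\varepsilon}-\nu\Delta u_{n+1}^{\varepsilon}+(u_{n+1}^{\varepsilon}\cdot\nabla)u_{n+1}^{\varepsilon}+\tfrac12(\nabla\cdot u_{n+1}^{\varepsilon})u_{n+1}^{\varepsilon}=f_{n+1},$$ $$\varepsilon_{n+1}\frac{p_{n+1}^{\varepsilon}-p_n^{\varepsilon}}{k_{n+1}}+\nabla\cdot u_{n+1}^{\varepsilon}=0\quad\text{in }\Omega,$$ with $u_0^{\varepsilon}=u_0$, $p_0^{\varepsilon}=p_0$ in $\Omega$ and $u_n^{\varepsilon}=0$ on $\partial\Omega$ for $n\ge 1$. Suppose that $f_n=0$ for all $n$ and that there is a constant $\beta$ such that $$\left|\frac{\varepsilon_{n+1}-\varepsilon_n}{k_n}\right|\le\beta\,\varepsilon_n\quad\text{for all }n\ge 0.$$ Then for all $n\ge 1$ $$\frac12\int_\Omega\left[|u_n^{\varepsilon}|^2+\varepsilon_n(p_n^{\varepsilon})^2\right]dx\le\left(\prod_{j=0}^{n-1}(1+k_j\beta)\right)\frac12\int_\Omega\left[|u_0|^2+\varepsilon_0(p_0)^2\right]dx\le e^{\beta t_n}\,\frac12\int_\Omega\left[|u_0|^2+\varepsilon_0(p_0)^2\right]dx,$$ where $t_n=\sum_{j=0}^{n-1}k_j$.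
   Context: $\Omega$ is a bounded open subset of $\mathbb{R}^3$ or $\Omega=\mathbb{R}^3$ (in which case there is no boundary condition). $\nu>0$ is the viscosity; $k_n>0$ are the timesteps and $\varepsilon_n>0$ the artificial compression parameters, $n\ge 0$, both allowed to vary with $n$. The superscript $\varepsilon$ is only a label. The scheme is discrete in time and continuous in space: $u_0\in L^2(\Omega)^3$, $p_0\in L^2(\Omega)$ and, for $n\ge 1$, $u_n^{\varepsilon}\in H_0^1(\Omega)^3$, $p_n^{\varepsilon}\in L^2(\Omega)$, with the momentum equation understood in the usual weak form tested against $H^1_0(\Omega)^3$ functions. *)

(* Defs.v *)
From HB Require Import structures.
From mathcomp Require Import all_boot all_order all_algebra.
From mathcomp Require Import all_classical all_reals all_analysis.

Set Implicit Arguments.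
Unset Strict Implicit.
Unset Printing Implicit Defensive.

Import Order.TTheory GRing.Theory Num.Theory.
Import numFieldNormedType.Exports.

Local Open Scope classical_set_scope.
Local Open Scope ring_scope.

Notation R3 R := (R * R * R)%type.

(* The sigma-finite instance of the library is not found by unification for a
   general product measure, so it is redeclared below for leb2 and leb3. *)
Lemma sigma_finite_prod d1 d2 (T1 : measurableType d1) (T2 : measurableType d2)
    (R : realType) (m1 : {sigma_finite_measure set T1 -> \bar R})
    (m2 : {sigma_finite_measure set T2 -> \bar R}) :
  sigma_finite setT (m1 \x m2)%E.
Proof.
have /sigma_finiteP[F [TF ndF Foo]] := sigma_finiteT m1.
have /sigma_finiteP[G [TG ndG Goo]] := sigma_finiteT m2.
exists (fun n => F n `*` G n).
  rewrite -setXTT TF TG predeqE => -[x y]; split.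
    move=> [/= [n _ Fnx] [k _ Gky]]; exists (maxn n k) => //; split.
    - by move: x Fnx; exact/subsetPset/ndF/leq_maxl.
    - by move: y Gky; exact/subsetPset/ndG/leq_maxr.
  by move=> [n _ []/= ? ?]; split; exists n.
move=> k; have [? ?] := Foo k; have [? ?] := Goo k.
split; first exact: measurableX.
by rewrite product_measure1E// lte_mul_pinfty// ge0_fin_numE.
Qed.

Section Spaces.
Variable R : realType.
Implicit Types (Om : set (R3 R)) (f g phi : R3 R -> R) (i j : 'I_3).

Definition leb2 : set (measurableTypeR R * measurableTypeR R) -> \bar R :=
  (@lebesgue_measure R \x @lebesgue_measure R)%E.

HB.instance Definition _ := Measure.on leb2.
HB.instance Definition _ := Measure_isSigmaFinite.Build _ _ _ leb2
  (sigma_finite_prod (@lebesgue_measure R) (@lebesgue_measure R)).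

Definition leb3 :
    set (measurableTypeR R * measurableTypeR R * measurableTypeR R) -> \bar R :=
  (leb2 \x @lebesgue_measure R)%E.

HB.instance Definition _ := Measure.on leb3.
HB.instance Definition _ := Measure_isSigmaFinite.Build _ _ _ leb3
  (sigma_finite_prod leb2 (@lebesgue_measure R)).

Definition e3 i : R3 R := ((val i == 0%N)%:R, (val i == 1%N)%:R, (val i == 2%N)%:R).

Definition pd j f : R3 R -> R := fun x => 'D_(e3 j) f x.

(* C^oo: all iterated partial derivatives exist and are continuous *)
Definition smooth f := forall s : seq 'I_3,
  continuous (foldr pd f s) /\ forall j x, derivable (foldr pd f s) x (e3 j).

Definition test_fun Om phi :=
  [/\ smooth phi, compact (closure [set x | phi x != 0])
    & closure [set x | phi x != 0] `<=` Om].

(* Functions on Om are total functions of which only the restriction to Om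
   matters; L^2 is taken with respect to Borel representatives. *)
Definition L2 Om f := f \_ Om \in Lfun leb3 2%:E.

Definition L2_cvg Om (F : nat -> R3 R -> R) f :=
  (fun m => ('N[leb3]_2%:E[EFin \o ((F m \- f)%R \_ Om)])%E) @ \oo --> 0%E.

Definition is_weak_pd Om j f g := forall phi, test_fun Om phi ->
  \int[leb3]_(x in Om) (f x * pd j phi x)
    = - \int[leb3]_(x in Om) (g x * phi x).

(* A chosen representative of the weak derivative when the latter exists in
   L^2(Om), in which case it is unique up to a.e. equality; 0 otherwise. *)
Definition wpd Om j f : R3 R -> R :=
  xget (cst 0) [set g | L2 Om g /\ is_weak_pd Om j f g].

Definition H1 Om f := L2 Om f /\
  forall j, exists g, L2 Om g /\ is_weak_pd Om j f g.

(* closure of C_c^oo(Om) in H^1(Om) *)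
Definition H10 Om f := H1 Om f /\
  exists F : nat -> R3 R -> R,
    [/\ forall m, test_fun Om (F m), L2_cvg Om F f
      & forall j, L2_cvg Om (fun m => pd j (F m)) (wpd Om j f)].

Definition wdiv Om (v : 'I_3 -> R3 R -> R) : R3 R -> R :=
  fun x => \sum_(j < 3) wpd Om j (v j) x.

(* i-th component of (u . grad) u + 1/2 (div u) u *)
Definition convection Om (u : 'I_3 -> R3 R -> R) i : R3 R -> R :=
  fun x => \sum_(j < 3) u j x * wpd Om j (u i) x + 2^-1 * wdiv Om u x * u i x.

(* weak form of (u' - u)/k + grad p' - nu Lap u' + (u' . grad) u'
   + 1/2 (div u') u' = f, the pressure and viscous terms being integrated
   by parts *)
Definition weak_momentum Om (nu k : R) (u u' : 'I_3 -> R3 R -> R)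
    (p' : R3 R -> R) (f : 'I_3 -> R3 R -> R) :=
  forall v : 'I_3 -> R3 R -> R, (forall i, H10 Om (v i)) ->
    \int[leb3]_(x in Om) (\sum_(i < 3) (u' i x - u i x) / k * v i x)
    - \int[leb3]_(x in Om) (p' x * wdiv Om v x)
    + nu * \int[leb3]_(x in Om)
        (\sum_(i < 3) \sum_(j < 3) wpd Om j (u' i) x * wpd Om j (v i) x)
    + \int[leb3]_(x in Om) (\sum_(i < 3) convection Om u' i x * v i x)
    = \int[leb3]_(x in Om) (\sum_(i < 3) f i x * v i x).

(* 1/2 int_Om (|u|^2 + eps p^2) *)
Definition energy Om (eps : R) (u : 'I_3 -> R3 R -> R) (p : R3 R -> R) : R :=
  2^-1 * \int[leb3]_(x in Om) (\sum_(i < 3) u i x ^+ 2 + eps * p x ^+ 2).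

End Spaces.

(* Main.v *)
Require Import Defs.
From HB Require Import structures.
From mathcomp Require Import all_boot all_order all_algebra.
From mathcomp Require Import all_classical all_reals all_analysis.
From mathcomp Require Import measurable_realfun ring lra.

Set Implicit Arguments.
Unset Strict Implicit.
Unset Printing Implicit Defensive.

Import Order.TTheory GRing.Theory Num.Theory.
Import numFieldNormedType.Exports.

Local Open Scope classical_set_scope.
Local Open Scope ring_scope.

(** The estimate is the discrete energy balance, obtained by testing the
    momentum equation with the new velocity u' = u_(n+1).  The viscous term is
    nonnegative, the right-hand side vanishes, and the pressure term becomes
    (eps/k) int p' (p' - p) once div u' is replaced using the continuity
    equation.  The identity 2 (a - b) a = a^2 - b^2 + (a - b)^2, applied to the
    velocity and to the pressure, yields, with eps = eps_(n+1),
      |u'|^2 + eps |p'|^2 <= |u|^2 + eps |p|^2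
    in L2 norms ([energy_step]).  Since eps_(n+1) <= (1 + k_n beta) eps_n and
    beta >= 0, the energy grows by at most the factor 1 + k_n beta per step;
    the exponential bound is 1 + x <= exp x.

    The real work is that the convection term contributes nothing
    ([integral_convection]).  Its integrand is half of the sum over i and j of
    the formal derivative d_j (u_j u_i^2), so it suffices that
      int ((d_j a) b^2 + 2 a b (d_j b)) = 0  for a, b in H^1_0
    ([integral_pd_mulsqr_eq0]).  For compactly supported C^1 functions this is
    the fundamental theorem of calculus along lines combined with Tonelli.
    To pass to the limit along approximating test functions one needs
    convergence in L4, because the integrand is a product of a derivative,
    converging in L2, with two functions.  In dimension three this is
    provided by the Ladyzhenskaya inequality |phi|_4 <= C |phi|_(H^1)
    ([ladyzhenskaya]), which is first proved for C^1 functions with compact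
    support, then carried over to limits of such functions
    ([sqint_sqr_limit]), and finally applied to the differences between a
    function and its approximations ([H10_lim_L4_cvg]).

    Functions on Om are everywhere replaced by their extensions by zero, so
    that all integrals are over the whole space; test functions and their
    derivatives vanish outside Om, hence are their own extensions. *)

(** * Integrals of squares *)

Section square_integral.
Context d (T : measurableType d) (R : realType).
Variable mu : {measure set T -> \bar R}.
Implicit Types f g : T -> R.

Definition sqint f : \bar R := (\int[mu]_x ((f x) ^+ 2)%:E)%E.

Lemma sqint_ge0 f : (0 <= sqint f)%E.
Proof. by apply: integral_ge0 => x _; rewrite lee_fin sqr_ge0. Qed.

Lemma sqint_Lnorm f : ('N[mu]_2%:E[EFin \o f] = sqint f `^ 2^-1)%E.
Proof.
rewrite unlock; congr (_ `^ _)%E; apply: eq_integral => x _ /=.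
by rewrite powR_mulrn// -normrX ger0_norm// sqr_ge0.
Qed.

Lemma cauchy_schwarz_integral f g : measurable_fun setT f -> measurable_fun setT g ->
  (\int[mu]_x (`|f x * g x|)%:E <= sqint f `^ 2^-1 * sqint g `^ 2^-1)%E.
Proof.
move=> mf mg; have := @hoelder _ _ _ mu f g 2 2 mf mg.
rewrite Lnorm1 !sqint_Lnorm; apply => //.
by rewrite [RHS]splitr !div1r.
Qed.

Lemma le_integral_real (f g : T -> R) : measurable_fun setT f -> measurable_fun setT g ->
  (forall x, 0 <= f x <= g x) ->
  (\int[mu]_x (f x)%:E <= \int[mu]_x (g x)%:E)%E.
Proof.
move=> mf mg fg; apply: ge0_le_integral => //.
- by move=> x _; rewrite lee_fin; have /andP[] := fg x.
- exact/measurable_EFinP.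
- exact/measurable_EFinP.
- by move=> x _; rewrite lee_fin; have /andP[] := fg x.
Qed.

Lemma ge0_integralD_real f g : measurable_fun setT f -> measurable_fun setT g ->
  (forall x, 0 <= f x) -> (forall x, 0 <= g x) ->
  (\int[mu]_x (f x + g x)%:E = \int[mu]_x (f x)%:E + \int[mu]_x (g x)%:E)%E.
Proof.
move=> mf mg f0 g0; rewrite -ge0_integralD//; do ?exact/measurable_EFinP.
- by move=> x _; rewrite lee_fin.
- by move=> x _; rewrite lee_fin.
Qed.

Lemma ge0_integralZl_real c f : measurable_fun setT f -> 0 <= c -> (forall x, 0 <= f x) ->
  (\int[mu]_x (c * f x)%:E = c%:E * \int[mu]_x (f x)%:E)%E.
Proof.
move=> mf c0 f0; rewrite -ge0_integralZl//; first exact/measurable_EFinP.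
by move=> x _; rewrite lee_fin.
Qed.

Lemma sqintD_le f g : measurable_fun setT f -> measurable_fun setT g ->
  (sqint (f \+ g)%R <= 2%:E * (sqint f + sqint g))%E.
Proof.
move=> mf mg.
have mX (h : T -> R) : measurable_fun setT h ->
    measurable_fun setT (fun x => h x ^+ 2).
  by move=> mh; exact: measurable_funX.
rewrite /sqint -ge0_integralD_real//; [|exact: mX|exact: mX|by move=> x; exact: sqr_ge0..].
rewrite -ge0_integralZl_real//; last 2 first.
- by apply: measurable_funD; exact: mX.
- by move=> x; rewrite addr_ge0// sqr_ge0.
apply: le_integral_real.
- by apply: measurable_funX; exact: measurable_funD.
- by apply: measurable_funM => //; apply: measurable_funD; exact: measurable_funX.
- move=> x; rewrite sqr_ge0/=; have := sqr_ge0 (f x - g x); rewrite /=; nra.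
Qed.

Lemma sqint_sub_sym f g : sqint (f \- g) = sqint (g \- f).
Proof. by apply: eq_integral => x _ /=; rewrite -sqrrN opprB. Qed.

End square_integral.

(** Needed because Cauchy-Schwarz produces square roots of square integrals,
    whereas convergence in L2 is recorded for the square integrals themselves. *)
Lemma cvg_poweR12_0 (R : realType) (z : nat -> \bar R) :
  (forall m, 0 <= z m)%E -> z @ \oo --> 0%E -> (z m `^ 2^-1)%E @[m --> \oo] --> 0%E.
Proof.
move=> z0 /fine_cvgP[zfin zc].
have : Num.sqrt ((fine \o z) m) @[m --> \oo] --> Num.sqrt (0 : R).
  exact: (cvg_comp _ _ zc (@sqrt_continuous _ _)).
rewrite sqrtr0 => zs; apply/fine_cvgP; split.
  by apply: filterS zfin => m zm; rewrite fin_num_poweR.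
apply: cvg_trans zs; apply: near_eq_cvg.
by apply: nearW => m /=; rewrite fine_poweR powR12_sqrt// fine_ge0.
Qed.

(** * Limits of products in L1 and L2 *)

Lemma squeeze_cvge0 (R : realType) (u v : nat -> \bar R) :
  (forall m, 0 <= u m <= v m)%E -> v @ \oo --> 0%E -> u @ \oo --> 0%E.
Proof.
move=> uv; apply: (@squeeze_cvge _ _ _ _ (cst 0%E)); first exact: nearW.
exact: cvg_cst.
Qed.

Lemma cvgeD0 (R : realType) (u v : nat -> \bar R) :
  u @ \oo --> 0%E -> v @ \oo --> 0%E -> (u \+ v)%E @ \oo --> 0%E.
Proof. by move=> u0 v0; rewrite -[X in _ --> X]adde0; apply: cvgeD. Qed.

Lemma cvgeZ0 (R : realType) (c : \bar R) (u : nat -> \bar R) :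
  c \is a fin_num -> u @ \oo --> 0%E -> (c * u m)%E @[m --> \oo] --> 0%E.
Proof.
by move=> fc u0; rewrite -[X in _ --> X](mule0 c); apply: cvgeZl.
Qed.

Section products_of_limits.
Context d (T : measurableType d) (R : realType).
Variable mu : {measure set T -> \bar R}.
Implicit Types (f g x y : T -> R).
Local Notation sqint := (sqint mu).

Definition L1_cvg (f_ : nat -> T -> R) f :=
  (\int[mu]_t (`|f_ m t - f t|)%:E)%E @[m --> \oo] --> 0%E.
Definition sqint_cvg (f_ : nat -> T -> R) f := sqint (f_ m \- f) @[m --> \oo] --> 0%E.

Lemma int_normM_cvg0 (x_ y_ : nat -> T -> R) :
  (forall m, measurable_fun setT (x_ m)) -> (forall m, measurable_fun setT (y_ m)) ->
  sqint (x_ m) @[m --> \oo] --> 0%E -> sqint (y_ m) @[m --> \oo] --> 0%E ->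
  (\int[mu]_t (`|x_ m t * y_ m t|)%:E)%E @[m --> \oo] --> 0%E.
Proof.
move=> mx my x0 y0.
apply: (@squeeze_cvge0 _ _ (fun m => sqint (x_ m) `^ 2^-1 * sqint (y_ m) `^ 2^-1)%E).
  by move=> m; rewrite integral_ge0//= cauchy_schwarz_integral.
rewrite -(mule0 0%E); apply: cvgeM; first by rewrite mule_def_fin.
- by apply: cvg_poweR12_0 => // m; exact: sqint_ge0.
- by apply: cvg_poweR12_0 => // m; exact: sqint_ge0.
Qed.

Lemma int_normMr_cvg0 (x_ : nat -> T -> R) y :
  (forall m, measurable_fun setT (x_ m)) -> measurable_fun setT y ->
  sqint (x_ m) @[m --> \oo] --> 0%E -> (sqint y < +oo)%E ->
  (\int[mu]_t (`|x_ m t * y t|)%:E)%E @[m --> \oo] --> 0%E.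
Proof.
move=> mx my x0 yoo.
apply: (@squeeze_cvge0 _ _ (fun m => sqint y `^ 2^-1 * sqint (x_ m) `^ 2^-1)%E).
  by move=> m; rewrite integral_ge0//= muleC cauchy_schwarz_integral.
apply: cvgeZ0; last by apply: cvg_poweR12_0 => // m; exact: sqint_ge0.
by rewrite fin_num_poweR// ge0_fin_numE// sqint_ge0.
Qed.

Lemma integrableM_sqint x y : measurable_fun setT x -> measurable_fun setT y ->
  (sqint x < +oo)%E -> (sqint y < +oo)%E ->
  mu.-integrable setT (fun t => (x t * y t)%:E).
Proof.
move=> mx my xoo yoo; apply/integrableP; split.
  by apply/measurable_EFinP; exact: measurable_funM.
apply: (le_lt_trans (cauchy_schwarz_integral mu mx my)).
by rewrite lte_mul_pinfty ?poweR_ge0 ?fin_num_poweR ?poweR_lty// ge0_fin_numE ?sqint_ge0.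
Qed.

(** The difference of the products is (x_m - x)(y_m - y) + (x_m - x) y +
    (y_m - y) x, and each term is controlled by Cauchy-Schwarz; comparing with
    the limits x and y spares a uniform bound on the sequences. *)
Lemma L1_cvgM (x_ y_ : nat -> T -> R) x y :
  (forall m, measurable_fun setT (x_ m)) -> (forall m, measurable_fun setT (y_ m)) ->
  measurable_fun setT x -> measurable_fun setT y ->
  (sqint x < +oo)%E -> (sqint y < +oo)%E ->
  sqint_cvg x_ x -> sqint_cvg y_ y -> L1_cvg (fun m => x_ m \* y_ m) (x \* y).
Proof.
move=> mx_ my_ mx my xoo yoo xc yc.
have mdx m : measurable_fun setT (x_ m \- x) by exact: measurable_funB.
have mdy m : measurable_fun setT (y_ m \- y) by exact: measurable_funB.
have c1 := int_normM_cvg0 mdx mdy xc yc.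
have c2 := int_normMr_cvg0 mdx my xc yoo.
have c3 := int_normMr_cvg0 mdy mx yc xoo.
apply: squeeze_cvge0 (cvgeD0 (cvgeD0 c1 c2) c3) => m.
have mn f : measurable_fun setT f -> measurable_fun setT (fun t => `|f t|).
  by move=> mf; exact: measurableT_comp.
have mm1 := mn _ (measurable_funM (mdx m) (mdy m)).
have mm2 := mn _ (measurable_funM (mdx m) my).
have mm3 := mn _ (measurable_funM (mdy m) mx).
rewrite integral_ge0//= -ge0_integralD_real// -ge0_integralD_real//; last first.
  exact: measurable_funD.
apply: le_integral_real.
- by apply: mn; apply: measurable_funB; exact: measurable_funM.
- by apply: measurable_funD => //; exact: measurable_funD.
- move=> t; rewrite normr_ge0/=.
  have -> : x_ m t * y_ m t - x t * y t = (x_ m t - x t) * (y_ m t - y t)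
    + (x_ m t - x t) * y t + (y_ m t - y t) * x t by ring.
  by rewrite (le_trans (ler_normD _ _))// lerD2r ler_normD.
Qed.

Lemma L1_cvgD (x_ y_ : nat -> T -> R) x y :
  (forall m, measurable_fun setT (x_ m)) -> (forall m, measurable_fun setT (y_ m)) ->
  measurable_fun setT x -> measurable_fun setT y ->
  L1_cvg x_ x -> L1_cvg y_ y -> L1_cvg (fun m => x_ m \+ y_ m) (x \+ y).
Proof.
move=> mx_ my_ mx my xc yc; apply: squeeze_cvge0 (cvgeD0 xc yc) => m.
have mn f g : measurable_fun setT f -> measurable_fun setT g ->
    measurable_fun setT (fun t => `|f t - g t|).
  by move=> mf mg; apply: measurableT_comp => //; exact: measurable_funB.
rewrite integral_ge0//= -ge0_integralD_real//; [|exact: mn..].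
apply: le_integral_real.
- by apply: mn; exact: measurable_funD.
- by apply: measurable_funD => //; exact: mn.
- by move=> t; rewrite normr_ge0/= opprD addrACA ler_normD.
Qed.

(** Convergence in L4 is expressed by the square integrals of the squared
    differences, so that Cauchy-Schwarz applied to squares replaces the Hoelder
    inequality with exponents 4, 4 and 2. *)
Lemma sqint_cvgM (x_ y_ : nat -> T -> R) x y :
  (forall m, measurable_fun setT (x_ m)) -> (forall m, measurable_fun setT (y_ m)) ->
  measurable_fun setT x -> measurable_fun setT y ->
  (sqint (fun t => x t ^+ 2)%R < +oo)%E -> (sqint (fun t => y t ^+ 2)%R < +oo)%E ->
  sqint (fun t => (x_ m t - x t) ^+ 2) @[m --> \oo] --> 0%E ->
  sqint (fun t => (y_ m t - y t) ^+ 2) @[m --> \oo] --> 0%E ->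
  sqint_cvg (fun m => x_ m \* y_ m) (x \* y).
Proof.
move=> mx_ my_ mx my xoo yoo xc yc.
have msq f : measurable_fun setT f -> measurable_fun setT (fun t => f t ^+ 2).
  by move=> mf; exact: measurable_funX.
have mdx m : measurable_fun setT (fun t => (x_ m t - x t) ^+ 2).
  by apply: msq; exact: measurable_funB.
have mdy m : measurable_fun setT (fun t => (y_ m t - y t) ^+ 2).
  by apply: msq; exact: measurable_funB.
have c1 := int_normM_cvg0 mdx mdy xc yc.
have c2 := int_normMr_cvg0 mdx (msq _ my) xc yoo.
have c3 := int_normMr_cvg0 mdy (msq _ mx) yc xoo.
have c := @cvgeZ0 R 3%:E _ isT (cvgeD0 (cvgeD0 c1 c2) c3).
apply: squeeze_cvge0 c => m.
have mn f : measurable_fun setT f -> measurable_fun setT (fun t => `|f t|).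
  by move=> mf; exact: measurableT_comp.
have mm1 := mn _ (measurable_funM (mdx m) (mdy m)).
have mm2 := mn _ (measurable_funM (mdx m) (msq _ my)).
have mm3 := mn _ (measurable_funM (mdy m) (msq _ mx)).
have mm12 := measurable_funD mm1 mm2.
have mm123 := measurable_funD mm12 mm3.
rewrite sqint_ge0/= -ge0_integralD_real// -ge0_integralD_real// -ge0_integralZl_real//.
apply: le_integral_real.
- by apply: msq; apply: measurable_funB; exact: measurable_funM.
- by apply: measurable_funM => //; exact: (measurable_funD mm12 mm3).
- move=> t; rewrite sqr_ge0/=.
  rewrite -!exprMn !ger0_norm ?sqr_ge0//.
  set a := x_ m t; set b := y_ m t.
  have := sqr_ge0 ((a - x t) * (b - y t) - (a - x t) * y t).
  have := sqr_ge0 ((a - x t) * (b - y t) - (b - y t) * x t).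
  have := sqr_ge0 ((b - y t) * x t - (a - x t) * y t).
  by move=> /=; lra.
Qed.

Lemma sqintM_lty x y : measurable_fun setT x -> measurable_fun setT y ->
  (sqint (fun t => x t ^+ 2)%R < +oo)%E -> (sqint (fun t => y t ^+ 2)%R < +oo)%E ->
  (sqint (x \* y)%R < +oo)%E.
Proof.
move=> mx my xoo yoo.
have [] := integrableP _ _ _ (integrableM_sqint (measurable_funX 2 mx)
  (measurable_funX 2 my) xoo yoo).
move=> _; apply: le_lt_trans; apply: le_integral_real.
- by apply: measurable_funX; exact: measurable_funM.
- by apply: measurableT_comp => //; apply: measurable_funM; exact: measurable_funX.
- by move=> t; rewrite sqr_ge0/= exprMn ler_norm.
Qed.

(** The totalized integrals of the x_m may vanish for lack of integrability, but
    all but finitely many x_m are integrable, being at finite L1 distance of x. *)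
Lemma L1_cvg_Rintegral0 (x_ : nat -> T -> R) x :
  (forall m, measurable_fun setT (x_ m)) ->
  mu.-integrable setT (EFin \o x) -> L1_cvg x_ x ->
  (forall m, \int[mu]_t x_ m t = 0) -> \int[mu]_t x t = 0.
Proof.
move=> mx_ ix xc x0.
have mx : measurable_fun setT x by have /measurable_EFinP := measurable_int mu ix.
apply/eqP; rewrite -normr_eq0 eq_le normr_ge0 andbT -lee_fin.
(* the integral of x equals minus that of x_m - x for every m *)
apply: (cvge_ge _ xc); near=> m.
have mn : measurable_fun setT (x_ m \- x) by exact: measurable_funB.
have dfin : mu.-integrable setT (EFin \o (x_ m \- x)).
  apply/integrableP; split; first exact/measurable_EFinP.
  near: m; have /fine_cvgP[+ _] := xc; apply: filterS => m.
  by rewrite ge0_fin_numE// integral_ge0.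
rewrite (_ : \int[mu]_t x t = - \int[mu]_t (x_ m \- x) t); last first.
  have -> : \int[mu]_t x t = \int[mu]_t x_ m t - \int[mu]_t (x_ m \- x) t.
    rewrite -RintegralB//.
      by apply: eq_Rintegral => t _ /=; rewrite subKr.
    have := integrableD measurableT dfin ix; congr (mu.-integrable _ _).
    by apply/funext => t /=; rewrite -EFinD subrK.
  by rewrite x0 sub0r.
rewrite normrN EFin_normr_Rintegral//.
by apply: le_abse_integral => //; exact/measurable_EFinP.
Unshelve. all: by end_near. Qed.

End products_of_limits.

(** * Borel measurability of continuous functions on the space *)

Section continuous_measurable_R3.
Variable R : realType.

(** Boxes with rational centre and inverse integer radius: a countable family
    of measurable sets through which every open set is exhausted. *)
Definition box3 (q : rat * rat * rat) (n : nat) : set (R3 R) :=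
  (ball (ratr q.1.1 : R) n.+1%:R^-1 `*` ball (ratr q.1.2 : R) n.+1%:R^-1)
    `*` ball (ratr q.2 : R) n.+1%:R^-1.

Lemma measurable_box3 q n :
  measurable (box3 q n : set (measurableTypeR R * measurableTypeR R * measurableTypeR R)).
Proof. by do 2 ?apply: measurableX => //; exact: measurable_ball. Qed.

Lemma ratr_ball (x e : R) : 0 < e -> exists q : rat, ball (ratr q : R) e x.
Proof.
move=> e0; have [|q] := @rat_in_itvoo R (x - e) (x + e); first lra.
rewrite in_itv/= => /andP[q1 q2]; exists q.
by rewrite -ball_normE/= ltr_norml; apply/andP; split; lra.
Qed.

Lemma open_measurable_R3 (U : set (R3 R)) : open U ->
  measurable (U : set (measurableTypeR R * measurableTypeR R * measurableTypeR R)).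
Proof.
move=> oU.
have -> : U = \bigcup_(p in [set: rat * rat * rat * nat])
    (if `[< box3 p.1 p.2 `<=` U >] then box3 p.1 p.2 else set0).
  apply/seteqP; split=> [x Ux|x [[q n] _]/=]; last first.
    by case: asboolP => // + h; apply.
  have /nbhs_ballP[e /= e0 xeU] := open_nbhs_nbhs (conj oU Ux).
  have [n] : exists n : nat, n.+1%:R^-1 < e / 2.
    have : \forall n \near \oo, n.+1%:R^-1 < e / 2 :> R.
      by apply: (near_infty_natSinv_lt (PosNum (divr_gt0 e0 (ltr0Sn _ 1)))).
    by case=> N _ /(_ N (leqnn N)) ?; exists N.
  move=> ne; have n0 : 0 < n.+1%:R^-1 :> R by rewrite invr_gt0.
  have [q1 hq1] := ratr_ball x.1.1 n0.
  have [q2 hq2] := ratr_ball x.1.2 n0.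
  have [q3 hq3] := ratr_ball x.2 n0.
  exists ((q1, q2, q3), n) => //=; case: asboolP => [_|]; first by [].
  case=> y [[y1 y2] y3]; apply: xeU.
  have bb (q : rat) s t : ball (ratr q : R) n.+1%:R^-1 s ->
      ball (ratr q : R) n.+1%:R^-1 t -> ball s e t.
    move=> /ball_sym hs ht; have := ball_triangle hs ht.
    by apply: le_ball; rewrite (splitr e) lerD// ltW.
  by split; [split|]; [exact: bb hq1 y1|exact: bb hq2 y2|exact: bb hq3 y3].
apply: countable_bigcupT_measurable => // p.
by case: asboolP => // _; exact: measurable_box3.
Qed.

Lemma continuous_measurable_R3 (f : R3 R -> R) : continuous f ->
  measurable_fun
    (setT : set (measurableTypeR R * measurableTypeR R * measurableTypeR R)) f.
Proof.
move=> /continuousP cf; apply: (measurability _ (RGenOpens.measurableE R)).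
move=> _ [_ [a [b ->] <-]]; rewrite setTI; apply: open_measurable_R3.
exact/cf/interval_open.
Qed.

End continuous_measurable_R3.

(** * The fundamental theorem of calculus on a line *)

Lemma derive_near0 (R : realType) (V W : normedModType R) (f : V -> W) (x v : V) :
  (\forall y \near x, f y = 0) -> 'D_v f x = 0.
Proof.
move=> f0; rewrite /derive; apply: lim_near_cst => //=.
have fx : f x = 0 := nbhs_singleton f0.
have hc : (fun h : R => h *: v + x) @ (0 : R) --> 0 *: v + x.
  by apply: cvgD; [apply: (@scalel_continuous R V v 0)|apply: cvg_cst].
rewrite scale0r add0r in hc; have h0 := hc _ f0.
have h1 : \forall h \near (0 : R)^', f (h *: v + x) = 0 by exact: nbhs_dnbhs h0.
by apply: filterS h1 => h /= ->; rewrite fx subr0 scaler0.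
Qed.

Section line.
Variable R : realType.
Local Notation mu := (@lebesgue_measure R).
Variables (f f' : R -> R) (M : R).
Hypothesis f'c : continuous f'.
Hypothesis df : forall x : R, is_derive x (1 : R) f (f' x).
Hypothesis f0 : forall x, M < `|x| -> f x = 0.
Hypothesis f'0 : forall x, M < `|x| -> f' x = 0.

Let itv_FTC (a b : R) : a < b ->
  (\int[mu]_(x in `[a, b]) (f' x)%:E = (f b)%:E - (f a)%:E)%E.
Proof.
have fc x : {for x, continuous f}.
  by apply/differentiable_continuous/derivable1_diffP; exact: (@ex_derive _ _ _ _ _ _ _ (df x)).
move=> ab; apply: continuous_FTC2 => //.
- exact: continuous_subspaceT.
- split=> [x _||]; first exact: (@ex_derive _ _ _ _ _ _ _ (df x)).
  + exact/cvg_at_right_filter/fc.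
  + exact/cvg_at_left_filter/fc.
- by move=> x _; rewrite derive1E; exact: (@derive_val _ _ _ _ _ _ _ (df x)).
Qed.

Let f'm : measurable_fun setT f'.
Proof. exact: continuous_measurable_fun. Qed.

(** Integrate f' from a point to the left of the support up to x. *)
Lemma norm_le_integral_derive (x : R) :
  (`|f x|%:E <= \int[mu]_t (`|f' t|)%:E)%E.
Proof.
pose a := - (`|M| + `|x| + 1).
have ax : a < x.
  by rewrite /a; have := ler_norm (- x); have := normr_ge0 M; rewrite normrN; lra.
have := itv_FTC ax; rewrite (f0 (x := a)); last first.
  by rewrite /a normrN gtr0_norm; have := ler_norm M; have := normr_ge0 M;
    have := normr_ge0 x; lra.
rewrite sube0 => /(congr1 abse) /= <-.
have mi : measurable `[a, x]%classic by exact: measurable_itv.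
apply: (le_trans (le_abse_integral mu mi _)).
  by apply/measurable_EFinP; exact: measurable_funTS.
apply: ge0_subset_integral => //; first by apply/measurable_EFinP; exact: measurableT_comp.
Qed.

(** That the integral of f' vanishes is stated as an equality of nonnegative
    integrals, the form to which Tonelli applies without any integrability
    check. *)
Lemma integral_derive_pos_neg :
  (\int[mu]_t ((EFin \o f')^\+ t) = \int[mu]_t ((EFin \o f')^\- t))%E.
Proof.
pose N := `|M| + 1.
have N0 : 0 < N by rewrite /N; have := normr_ge0 M; lra.
have MN : M < N by rewrite /N; have := ler_norm M; lra.
have h0 := itv_FTC (a := - N) (b := N); rewrite f0 ?normrN ?gtr0_norm// in h0.
rewrite f0 ?normrN ?gtr0_norm// subee// in h0.
have fE : EFin \o f' = (EFin \o f') \_ `[- N, N].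
  apply/funext => t; rewrite patchE; case: ifPn => //.
  rewrite notin_setE/= in_itv/= => /negP; rewrite -ler_norml -ltNge => tN.
  by rewrite f'0//; exact: lt_trans tN.
have fi : mu.-integrable setT (EFin \o f').
  rewrite fE; apply/(@integrable_mkcond _ _ _ mu `[- N, N]) => //.
  apply: continuous_compact_integrable; first exact: segment_compact.
  exact: continuous_subspaceT.
have := integral_mkcond `[- N, N] (EFin \o f') (mu := mu).
rewrite -fE h0; last lra.
rewrite [in RHS]integralE => /esym/eqP.
rewrite sube_eq ?add0e; last 2 first.
- exact: integrable_pos_fin_num.
- by rewrite fin_num_adde_defl// integrable_neg_fin_num.
by move/eqP.
Qed.

End line.

(** * C^1 functions with compact support *)

Section C1c.
Variable R : realType.
Implicit Types (phi psi : R3 R -> R) (j : 'I_3).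

Definition C1c phi := [/\ continuous phi, forall j, continuous (pd j phi),
  forall j x, derivable phi x (e3 R j) &
  exists M : R, forall x : R3 R, M < `|x| -> phi x = 0].

Lemma pd_eq0 j phi x : (\forall y \near x, phi y = 0) -> pd j phi x = 0.
Proof. exact: derive_near0. Qed.

Lemma pd_support phi M : (forall x : R3 R, M < `|x| -> phi x = 0) ->
  forall j (x : R3 R), M < `|x| -> pd j phi x = 0.
Proof.
move=> phi0 j x Mx; apply: pd_eq0.
have : \forall y \near x, M < `|y|.
  by have := @cvgr_gt R _ _ _ _ _ (@norm_continuous R (R * R * R)%type x) _ Mx; exact.
by apply: filterS => y; exact: phi0.
Qed.

Lemma test_fun_C1c (Om : set (R3 R)) phi : test_fun Om phi -> C1c phi.
Proof.
case=> smooth_phi cpt _; split.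
- by have [] := smooth_phi [::].
- by move=> j; have [] := smooth_phi [:: j].
- by move=> j x; have [_] := smooth_phi [::]; exact.
- have [M [_ MB]] := compact_bounded cpt; exists (M + 1) => x Mx.
  apply: contraTeq Mx => phix; rewrite -leNgt; apply: (MB (M + 1)); first lra.
  exact: subset_closure.
Qed.

(** Outside Om a test function vanishes on a neighbourhood of each point, hence
    together with its derivatives: extension by zero does not change it. *)
Lemma test_fun_out (Om : set (R3 R)) phi x : test_fun Om phi -> ~ Om x ->
  phi x = 0 /\ forall j, pd j phi x = 0.
Proof.
case=> _ _ sOm Omx.
have clx : (~` closure [set y | phi y != 0]) x by move=> /sOm.
have : \forall y \near x, phi y = 0.
  have : nbhs x (~` closure [set y | phi y != 0]).
    by apply: open_nbhs_nbhs; split => //; exact/closed_openC/closed_closure.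
  apply: filterS => y ny; apply/eqP; apply: contra_notT ny => phiy.
  exact: subset_closure.
move=> phi0; split; first exact: nbhs_singleton phi0.
by move=> j; exact: pd_eq0.
Qed.

Lemma pdM j phi psi x : C1c phi -> C1c psi ->
  pd j (phi \* psi) x = phi x * pd j psi x + psi x * pd j phi x.
Proof.
move=> [_ _ dphi _] [_ _ dpsi _].
by rewrite /pd (@deriveM _ _ phi psi)//.
Qed.

Lemma C1cM phi psi : C1c phi -> C1c psi -> C1c (phi \* psi).
Proof.
move=> hphi hpsi; have [c1 cd1 d1 [M M1]] := hphi; have [c2 cd2 d2 _] := hpsi.
split.
- by move=> x; apply: cvgM; [exact: c1|exact: c2].
- move=> j x; rewrite (_ : pd j _ =
      (phi \* pd j psi) \+ (psi \* pd j phi)); last first.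
    by apply/funext => y; rewrite pdM.
  apply: cvgD; apply: cvgM;
    [exact: c1|exact: cd2|exact: c2|exact: cd1].
- by move=> j x; exact: (derivableM (d1 j x) (d2 j x)).
- by exists M => x Mx; rewrite /= M1// mul0r.
Qed.

Lemma pdB j phi psi x : C1c phi -> C1c psi ->
  pd j (phi \- psi) x = pd j phi x - pd j psi x.
Proof.
move=> [_ _ dphi _] [_ _ dpsi _].
by rewrite /pd (@deriveB _ _ _ phi psi)//.
Qed.

Lemma C1cB phi psi : C1c phi -> C1c psi -> C1c (phi \- psi).
Proof.
move=> hphi hpsi; have [c1 cd1 d1 [M M1]] := hphi; have [c2 cd2 d2 [N N2]] := hpsi.
split.
- by move=> x; apply: cvgB; [exact: c1|exact: c2].
- move=> j x; rewrite (_ : pd j _ = pd j phi \- pd j psi); last first.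
    by apply/funext => y; rewrite pdB.
  by apply: cvgB; [exact: cd1|exact: cd2].
- by move=> j x; exact: (derivableB (d1 j x) (d2 j x)).
- exists (Num.max M N) => x; rewrite gt_max => /andP[Mx Nx].
  by rewrite /= M1// N2// subrr.
Qed.

Lemma is_derive_line phi (v : R3 R) (l : R -> R3 R) :
  (forall h t, l (h + t) = h *: v + l t) -> (forall x, derivable phi x v) ->
  forall t : R, is_derive t (1 : R) (phi \o l) ('D_v phi (l t)).
Proof.
move=> lE dphi t.
have E : (fun h : R => h^-1 *: (((phi \o l) \o shift t) (h *: (1 : R)) - (phi \o l) t))
  = (fun h : R => h^-1 *: ((phi \o shift (l t)) (h *: v) - phi (l t))).
  by apply/funext => h /=; rewrite -lE [h *: 1]mulr1.
split; first by rewrite /derivable E; exact: dphi.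
by rewrite /derive E.
Qed.

Definition line0 (y z t : R) : R3 R := (t, y, z).
Definition line1 (x z t : R) : R3 R := (x, t, z).
Definition line2 (x y t : R) : R3 R := (x, y, t).

(** The last condition makes the line leave every ball, so that a compactly
    supported function restricts to one on the line. *)
Definition axis_line j (l : R -> R3 R) := [/\ continuous l,
  forall h t, l (h + t) = h *: e3 R j + l t & forall t, `|t| <= `|l t|].

Let i0 : 'I_3 := @Ordinal 3 0 isT.
Let i1 : 'I_3 := @Ordinal 3 1 isT.
Let i2 : 'I_3 := @Ordinal 3 2 isT.

Lemma axis_line0 y z : axis_line i0 (line0 y z).
Proof.
split=> [t|h t|t].
- apply: (@cvg_pair _ _ _ _ (nbhs ((t, y) : R * R)) (nbhs z)); last exact: cvg_cst.
  by apply: (@cvg_pair _ _ _ _ (nbhs t) (nbhs y)); [exact: cvg_id|exact: cvg_cst].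
- transitivity ((h * 1 + t, h * 0 + y, h * 0 + z) : R3 R); last by [].
  by rewrite mulr1 mulr0 !add0r.
- by rewrite !prod_normE/= !le_max lexx.
Qed.

Lemma axis_line1 x z : axis_line i1 (line1 x z).
Proof.
split=> [t|h t|t].
- apply: (@cvg_pair _ _ _ _ (nbhs ((x, t) : R * R)) (nbhs z)); last exact: cvg_cst.
  by apply: (@cvg_pair _ _ _ _ (nbhs x) (nbhs t)); [exact: cvg_cst|exact: cvg_id].
- transitivity ((h * 0 + x, h * 1 + t, h * 0 + z) : R3 R); last by [].
  by rewrite mulr1 mulr0 !add0r.
- by rewrite !prod_normE/= !le_max lexx ?orbT.
Qed.

Lemma axis_line2 x y : axis_line i2 (line2 x y).
Proof.
split=> [t|h t|t].
- by apply: (@cvg_pair _ _ _ _ (nbhs ((x, y) : R * R)) (nbhs t)); [exact: cvg_cst|exact: cvg_id].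
- transitivity ((h * 0 + x, h * 0 + y, h * 1 + t) : R3 R); last by [].
  by rewrite mulr1 mulr0 !add0r.
- by rewrite !prod_normE/= !le_max lexx ?orbT.
Qed.

Lemma C1c_norm_le_line j phi l t : C1c phi -> axis_line j l ->
  (`|phi (l t)|%:E <= \int[@lebesgue_measure R]_s (`|pd j phi (l s)|)%:E)%E.
Proof.
move=> [_ cd d [M M0]] [cl lE ln].
have Ml s : M < `|s| -> M < `|l s| by move=> /lt_le_trans; apply.
apply: (@norm_le_integral_derive _ (phi \o l) (pd j phi \o l) M).
- by move=> s; apply: continuous_comp; [exact: cl|exact: cd].
- exact: is_derive_line.
- by move=> s /Ml; exact: M0.
Qed.

Lemma C1c_line_pos_neg j phi l : C1c phi -> axis_line j l ->
  (\int[@lebesgue_measure R]_s ((fun x => (pd j phi x)%:E)^\+ (l s))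
    = \int[@lebesgue_measure R]_s ((fun x => (pd j phi x)%:E)^\- (l s)))%E.
Proof.
move=> [_ cd d [M M0]] [cl lE ln].
have Ml s : M < `|s| -> M < `|l s| by move=> /lt_le_trans; apply.
have cl' : continuous (pd j phi \o l).
  by move=> s; apply: continuous_comp; [exact: cl|exact: cd].
have dl : forall s : R, is_derive s (1 : R) (phi \o l) ((pd j phi \o l) s).
  exact: is_derive_line.
have := @integral_derive_pos_neg _ (phi \o l) (pd j phi \o l) M cl' dl.
move=> /(_ (fun s Ms => M0 _ (Ml s Ms))) /(_ (fun s Ms => pd_support M0 _ (Ml s Ms))) e.
transitivity (\int[@lebesgue_measure R]_t ((EFin \o (pd j phi \o l))^\+ t))%E.
  by apply: eq_integral => t _; rewrite !funeposE.
by rewrite e; apply: eq_integral => t _; rewrite !funenegE.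
Qed.

End C1c.

(** * Tonelli on the plane and on the space *)

Variant ord3_spec : 'I_3 -> Prop :=
| Ord3_0 : ord3_spec (@Ordinal 3 0 isT)
| Ord3_1 : ord3_spec (@Ordinal 3 1 isT)
| Ord3_2 : ord3_spec (@Ordinal 3 2 isT).

Lemma ord3P j : ord3_spec j.
Proof.
by case: j => -[|[|[|//]]] h; rewrite (bool_irrelevance h isT); constructor.
Qed.

Section tonelli.
Variable R : realType.
Local Notation T1 := (measurableTypeR R).
Local Notation T2 := (measurableTypeR R * measurableTypeR R)%type.
Local Notation T3 := (measurableTypeR R * measurableTypeR R * measurableTypeR R)%type.
Local Notation leb := (@lebesgue_measure R).
Local Notation leb2 := (@leb2 R).
Local Notation leb3 := (@leb3 R).
Local Open Scope ereal_scope.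

Lemma tonelli_leb2_yx (h : T2 -> \bar R) : measurable_fun setT h ->
  (forall x, 0 <= h x) ->
  \int[leb2]_w h w = \int[leb]_y \int[leb]_x h (x, y).
Proof. by move=> mh h0; exact: (fubini_tonelli2 (m1 := leb) (m2 := leb)). Qed.

Lemma tonelli_leb2_xy (h : T2 -> \bar R) : measurable_fun setT h ->
  (forall x, 0 <= h x) ->
  \int[leb2]_w h w = \int[leb]_x \int[leb]_y h (x, y).
Proof. by move=> mh h0; exact: (fubini_tonelli1 (m1 := leb) (m2 := leb)). Qed.

Lemma tonelli_leb3_zw (h : T3 -> \bar R) : measurable_fun setT h ->
  (forall x, 0 <= h x) ->
  \int[leb3]_x h x = \int[leb]_z \int[leb2]_w h (w, z).
Proof. by move=> mh h0; exact: (fubini_tonelli2 (m1 := leb2) (m2 := leb)). Qed.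

Lemma tonelli_leb3_wz (h : T3 -> \bar R) : measurable_fun setT h ->
  (forall x, 0 <= h x) ->
  \int[leb3]_x h x = \int[leb2]_w \int[leb]_z h (w, z).
Proof. by move=> mh h0; exact: (fubini_tonelli1 (m1 := leb2) (m2 := leb)). Qed.

Lemma measurable_slice (d : measure_display) (U : measurableType d) (h : T3 -> U)
  (z : T1) : measurable_fun setT h -> measurable_fun setT (fun w : T2 => h (w, z)).
Proof. by move=> mh; apply: measurableT_comp => //; exact: measurable_pair2. Qed.

(** The square of u is at most a function of y alone times a function of x
    alone, and the integral of such a product factors. *)
Lemma sqint_leb2_le (u p q : T2 -> R) : measurable_fun setT u ->
  measurable_fun setT p -> measurable_fun setT q ->
  (forall x y, `|u (x, y)|%:E <= \int[leb]_s (`|p (s, y)|)%:E) ->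
  (forall x y, `|u (x, y)|%:E <= \int[leb]_s (`|q (x, s)|)%:E) ->
  sqint leb2 u <= (\int[leb2]_w (`|p w|)%:E) * (\int[leb2]_w (`|q w|)%:E).
Proof.
move=> mu mp mq up uq.
have mn (f : T2 -> R) : measurable_fun setT f ->
    measurable_fun setT (fun w => (`|f w|)%:E).
  by move=> mf; apply/measurable_EFinP; exact: measurableT_comp.
pose A (y : T1) := \int[leb]_s (`|p (s, y)|)%:E.
pose B (x : T1) := \int[leb]_s (`|q (x, s)|)%:E.
have mA : measurable_fun setT A.
  exact: (@measurable_fun_fubini_tonelli_G _ _ _ _ _ leb _ (mn _ mp)).
have mB : measurable_fun setT B.
  exact: (@measurable_fun_fubini_tonelli_F _ _ _ _ _ leb _ (mn _ mq)).
have A0 y : 0 <= A y by exact: integral_ge0.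
have B0 x : 0 <= B x by exact: integral_ge0.
have mAB : measurable_fun setT (fun w : T2 => A w.2 * B w.1).
  by apply: emeasurable_funM; apply: measurableT_comp.
apply: (@le_trans _ _ (\int[leb2]_w (A w.2 * B w.1))).
  apply: ge0_le_integral => //.
  - by move=> w _; rewrite lee_fin sqr_ge0.
  - by apply/measurable_EFinP; exact: measurable_funX.
  - move=> [x y] _; rewrite -[(_ ^+ 2)%R]ger0_norm ?sqr_ge0// normrX expr2 EFinM.
    by apply: lee_pmul; rewrite ?lee_fin//.
rewrite tonelli_leb2_yx//; last by move=> w; exact: mule_ge0.
rewrite tonelli_leb2_yx ?tonelli_leb2_xy//; do ?exact: mn.
under eq_integral => y _ do rewrite /= ge0_integralZl//.
by rewrite ge0_integralZr// integral_ge0.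
Qed.

(** The positive and the negative part of the derivative have the same integral
    on each line parallel to the axis j, hence on the space by Tonelli with
    that coordinate integrated first. *)
Lemma Rintegral_pd_eq0 (phi : R3 R -> R) (j : 'I_3) : C1c phi ->
  (\int[leb3]_x pd j phi x = 0)%R.
Proof.
move=> hphi; have [_ cd _ _] := hphi.
pose g (x : T3) := (pd j phi x)%:E.
have mg : measurable_fun setT g.
  by apply/measurable_EFinP; exact: continuous_measurable_R3.
have mgp := measurable_funepos mg; have mgn := measurable_funeneg mg.
suff e : \int[leb3]_x (g^\+ x) = \int[leb3]_x (g^\- x).
  rewrite /Rintegral integralE -/g e.
  (* if both parts have infinite integral, the difference is -oo and its finite
     part is 0 as well *)
  have [f|] := boolP (\int[leb3]_x (g^\- x) \is a fin_num).
    by rewrite subee.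
  by rewrite ge0_fin_numE ?integral_ge0// -leNgt leye_eq => /eqP ->.
have gp0 x : 0 <= g^\+ x by exact: funepos_ge0.
have gn0 x : 0 <= g^\- x by exact: funeneg_ge0.
case: (ord3P j) @g mg mgp mgn gp0 gn0 => g mg mgp mgn gp0 gn0.
- rewrite !tonelli_leb3_zw//; apply: eq_integral => z _.
  rewrite !tonelli_leb2_yx//; do ?exact: measurable_slice.
  apply: eq_integral => y _.
  exact: (C1c_line_pos_neg hphi (axis_line0 y z)).
- rewrite !tonelli_leb3_zw//; apply: eq_integral => z _.
  rewrite !tonelli_leb2_xy//; do ?exact: measurable_slice.
  apply: eq_integral => x _.
  exact: (C1c_line_pos_neg hphi (axis_line1 x z)).
- rewrite !tonelli_leb3_wz//; apply: eq_integral => -[x y] _.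
  exact: (C1c_line_pos_neg hphi (axis_line2 x y)).
Qed.

End tonelli.

(** * The Ladyzhenskaya inequality *)

(** The two plane integrals of the Ladyzhenskaya argument, each bounded by
    Cauchy-Schwarz, multiply to the mass s of a slice times the square root of
    d0 d1, which is at most d0 + d1. *)
Lemma lee_mul_sqrt (R : realType) (a b s d0 d1 : \bar R) :
  (0 <= s -> 0 <= d0 -> 0 <= d1 ->
   0 <= a -> 0 <= b ->
   a <= s `^ 2^-1 * d0 `^ 2^-1 -> b <= s `^ 2^-1 * d1 `^ 2^-1 ->
   a * b <= s * (d0 + d1))%E.
Proof.
move=> s0 d00 d10 a0 b0 ha hb.
have sq (z : \bar R) : (0 <= z -> z `^ 2^-1 * z `^ 2^-1 = z)%E.
  by move=> z0; rewrite poweR12_sqrt// -expe2 sqr_sqrte.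
have le01 (z w : \bar R) : (0 <= z -> 0 <= w -> z `^ 2^-1 <= (z + w) `^ 2^-1)%E.
  move=> z0 w0; apply: gt0_ler_poweR; rewrite ?in_itv/= ?leey ?andbT ?invr_ge0//.
    by rewrite adde_ge0.
  by rewrite leeDl.
apply: (le_trans (lee_pmul a0 b0 ha hb)).
rewrite muleACA sq//; apply: lee_wpmul2l => //.
rewrite -[leRHS]sq ?adde_ge0//; apply: lee_pmul; rewrite ?poweR_ge0//.
- exact: le01.
- by rewrite addeC; exact: le01.
Qed.

Section ladyzhenskaya.
Variable R : realType.
Local Notation T1 := (measurableTypeR R).
Local Notation T2 := (measurableTypeR R * measurableTypeR R)%type.
Local Notation T3 := (measurableTypeR R * measurableTypeR R * measurableTypeR R)%type.
Local Notation leb := (@lebesgue_measure R).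
Local Notation leb2 := (@leb2 R).
Local Notation leb3 := (@leb3 R).

(** The squared H^1 norm, with g in the role of the gradient of f. *)
Definition H1sq (f : R3 R -> R) (g : 'I_3 -> R3 R -> R) : \bar R :=
  (sqint leb3 f + \sum_(j < 3) sqint leb3 (g j))%E.

Lemma H1sq_ge0 f g : (0 <= H1sq f g)%E.
Proof. by rewrite adde_ge0 ?sqint_ge0// sume_ge0// => j _; exact: sqint_ge0. Qed.

Lemma H1sq_ge2 f g (j0 := @Ordinal 3 0 isT) (j1 := @Ordinal 3 1 isT) :
  (sqint leb3 (g j0) + sqint leb3 (g j1) <= H1sq f g)%E.
Proof.
rewrite /H1sq (bigD1 j0)// (bigD1 j1)// -[leLHS]add0e.
apply: leeD; first exact: sqint_ge0.
apply: leeD; first exact: lexx.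
by apply: leeDl; apply: sume_ge0 => j _; exact: sqint_ge0.
Qed.

(** Put psi = phi^2.  On the slice at height z, psi is bounded by the integral of
    its x-derivative along the x-line and by that of its y-derivative along the
    y-line, so the integral of psi^2 over the slice is at most the product of
    the plane integrals of these derivatives.  Cauchy-Schwarz bounds the product
    by 4 s(z) (D0(z) + D1(z)), where s and D_j are the integrals over the slice
    of phi^2 and of the squared derivatives.  Bounding psi by its z-derivative
    in the same way gives s(z) <= H for all z, where H is the squared H^1 norm,
    and integrating D0 + D1 over z costs another factor H. *)
Lemma ladyzhenskaya (phi : R3 R -> R) : C1c phi ->
  (sqint leb3 (fun x => phi x ^+ 2)%R
    <= 4%:E * (H1sq phi (fun j => pd j phi) * H1sq phi (fun j => pd j phi)))%E.
Proof.
move=> hphi; have [c cd _ _] := hphi.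
have mphi : measurable_fun (setT : set T3) phi by exact: continuous_measurable_R3.
have mpd j : measurable_fun (setT : set T3) (pd j phi).
  exact: continuous_measurable_R3.
set H := H1sq _ _; have H0 : (0 <= H)%E by exact: H1sq_ge0.
pose psi := phi \* phi; have hpsi : C1c psi by exact: C1cM.
have psiE j x : pd j psi x = 2 * (phi x * pd j phi x) by rewrite pdM//; ring.
have mpsi : measurable_fun (setT : set T3) psi by exact: measurable_funM.
have mpdpsi j : measurable_fun (setT : set T3) (pd j psi).
  by have [_ cdpsi _ _] := hpsi; exact: continuous_measurable_R3.
pose s (z : T1) := sqint leb2 (fun w => phi (w, z)).
pose D j (z : T1) := sqint leb2 (fun w => pd j phi (w, z)).
have s0 z : (0 <= s z)%E by exact: sqint_ge0.
have D0 j z : (0 <= D j z)%E by exact: sqint_ge0.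
have dpsi_le j z : (\int[leb2]_w (`|pd j psi (w, z)|)%:E
    <= 2%:E * (s z `^ 2^-1 * D j z `^ 2^-1))%E.
  under eq_integral do rewrite psiE normrM ger0_norm//.
  rewrite ge0_integralZl_real//; last first.
    apply: measurableT_comp => //; apply: measurable_funM; exact: measurable_slice.
  apply: lee_wpmul2l => //.
  by apply: cauchy_schwarz_integral; exact: measurable_slice.
pose j0 := @Ordinal 3 0 isT; pose j1 := @Ordinal 3 1 isT; pose j2 := @Ordinal 3 2 isT.
have sH z : (s z <= H)%E.
  apply: (@le_trans _ _ (\int[leb2]_w \int[leb]_t (`|pd j2 psi (w, t)|)%:E)%E).
    apply: ge0_le_integral => //.
    - by move=> w _; rewrite lee_fin sqr_ge0.
    - by apply/measurable_EFinP; apply: measurable_funX; exact: measurable_slice.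
    - have mn : measurable_fun (setT : set T3) (fun x => (`|pd j2 psi x|)%:E).
        by apply/measurable_EFinP; exact: measurableT_comp.
      exact: (@measurable_fun_fubini_tonelli_F _ _ _ _ _ leb _ mn).
    - move=> [x y] _; apply: le_trans (C1c_norm_le_line z hpsi (axis_line2 x y)).
      by rewrite lee_fin /line2 /psi/= -expr2 ler_norm.
  rewrite -(tonelli_leb3_wz (h := fun x => (`|pd j2 psi x|)%:E))//; last first.
    by apply/measurable_EFinP; exact: measurableT_comp.
  apply: (@le_trans _ _ (sqint leb3 phi + sqint leb3 (pd j2 phi))%E).
    have mX (f : T3 -> R) : measurable_fun setT f ->
        measurable_fun setT (fun x => f x ^+ 2).
      by move=> mf; exact: measurable_funX.
    rewrite /sqint -ge0_integralD_real; [|exact: mX|exact: mX|by move=> x; exact: sqr_ge0..].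
    apply: le_integral_real.
    - exact: measurableT_comp.
    - by apply: measurable_funD; exact: measurable_funX.
    - move=> x; rewrite normr_ge0/= psiE ler_norml; apply/andP; split.
        by have := sqr_ge0 (phi x + pd j2 phi x); nra.
      by have := sqr_ge0 (phi x - pd j2 phi x); nra.
  rewrite leeD2l// (bigD1 j2)//= leeDl// sume_ge0// => j _; exact: sqint_ge0.
have mD j : measurable_fun (setT : set T1) (D j).
  have m2 : measurable_fun (setT : set T3) (fun x => (pd j phi x ^+ 2)%:E).
    by apply/measurable_EFinP; exact: measurable_funX.
  have h0 x : (0 <= (pd j phi x ^+ 2)%:E)%E by rewrite lee_fin sqr_ge0.
  exact: (@measurable_fun_fubini_tonelli_G _ _ _ _ _ leb2 _ m2 h0).
pose S (z : T1) := sqint leb2 (fun w => psi (w, z)).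
have slice_le z : (S z <=
    4%:E * (H * (D j0 z + D j1 z)))%E.
  apply: (le_trans (sqint_leb2_le (p := fun w => pd j0 psi (w, z))
    (q := fun w => pd j1 psi (w, z)) _ _ _ _ _)).
  - exact: measurable_slice.
  - exact: measurable_slice.
  - exact: measurable_slice.
  - by move=> x y; exact: (C1c_norm_le_line x hpsi (axis_line0 y z)).
  - by move=> x y; exact: (C1c_norm_le_line y hpsi (axis_line1 x z)).
  apply: (le_trans (lee_pmul _ _ (dpsi_le j0 z) (dpsi_le j1 z))).
  - exact: integral_ge0.
  - exact: integral_ge0.
  rewrite muleACA -EFinM (_ : 2 * 2 = 4 :> R); last by ring.
  apply: lee_wpmul2l => //.
  apply: (@le_trans _ _ (s z * (D j0 z + D j1 z))%E).
    by apply: lee_mul_sqrt => //; rewrite mule_ge0 ?poweR_ge0.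
  by apply: lee_wpmul2r => //; rewrite adde_ge0.
have mS : measurable_fun (setT : set T1) S.
  have m4 : measurable_fun (setT : set T3) (fun x => (psi x ^+ 2)%:E).
    by apply/measurable_EFinP; exact: measurable_funX.
  have h0 x : (0 <= (psi x ^+ 2)%:E)%E by rewrite lee_fin sqr_ge0.
  exact: (@measurable_fun_fubini_tonelli_G _ _ _ _ _ leb2 _ m4 h0).
have DE j : (\int[leb]_z D j z = sqint leb3 (pd j phi))%E.
  rewrite [in RHS]/sqint tonelli_leb3_zw//.
    by apply/measurable_EFinP; exact: measurable_funX.
  by move=> x; rewrite lee_fin sqr_ge0.
have DH : (\int[leb]_z D j0 z + \int[leb]_z D j1 z <= H)%E.
  apply: le_trans (H1sq_ge2 phi (fun j => pd j phi)).
  by apply: leeD; rewrite le_eqVlt; apply/orP; left; apply/eqP; exact: DE.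
have -> : sqint leb3 (fun x => phi x ^+ 2) =
    (\int[leb]_z S z)%E.
  rewrite [LHS]/sqint tonelli_leb3_zw//.
    by apply/measurable_EFinP; do 2 apply: measurable_funX.
  by move=> x; rewrite lee_fin sqr_ge0.
have S0 z : (0 <= S z)%E by exact: sqint_ge0.
(* from here on the slice integrals enter only through their bounds *)
move: (D j0) (D j1) (mD j0) (mD j1) (D0 j0) (D0 j1) slice_le DH =>
  A B mA mB A0 B0 slice_le DH.
clear dpsi_le sH D0 mD DE D s s0; clearbody H S.
apply: (@le_trans _ _ (\int[leb]_z (4%:E * (H * (A z + B z))))%E).
  apply: ge0_le_integral => //.
  by do 2 apply: measurable_funeM; exact: emeasurable_funD.
have AB0 z : (0 <= A z + B z)%E by exact: adde_ge0.
rewrite ge0_integralZl//; last 2 first.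
- by apply: measurable_funeM; exact: emeasurable_funD.
- by move=> z _; exact: mule_ge0.
apply: lee_wpmul2l => //.
rewrite ge0_integralZl//; last exact: emeasurable_funD.
by apply: lee_wpmul2l => //; rewrite ge0_integralD.
Qed.

End ladyzhenskaya.

(** * The Ladyzhenskaya inequality for limits of C^1 functions *)

Section limits.
Variable R : realType.
Local Notation T3 := (measurableTypeR R * measurableTypeR R * measurableTypeR R)%type.
Local Notation leb3 := (@leb3 R).
Implicit Types (f : R3 R -> R) (g : 'I_3 -> R3 R -> R).

(** The trace of membership in H^1_0 that is used: approximation by C^1
    functions of compact support, with g in the role of the weak gradient. *)
Definition H10_lim (F : nat -> R3 R -> R) f g :=
  [/\ forall m, C1c (F m), measurable_fun (setT : set T3) f,
      forall j, measurable_fun (setT : set T3) (g j),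
      sqint leb3 (F m \- f) @[m --> \oo] --> 0%E &
      forall j, sqint leb3 (pd j (F m) \- g j) @[m --> \oo] --> 0%E].

Lemma H1sq_cvg0 (F : nat -> R3 R -> R) f g : H10_lim F f g ->
  H1sq (F m \- f) (fun j => pd j (F m) \- g j) @[m --> \oo] --> 0%E.
Proof.
move=> [_ _ _ cF cg]; rewrite /H1sq.
under eq_fun do rewrite !big_ord_recl big_ord0 adde0.
by do 3 ?[apply: cvgeD0 => //].
Qed.

Lemma H1sqD_le f1 f2 g1 g2 :
  measurable_fun (setT : set T3) f1 -> measurable_fun (setT : set T3) f2 ->
  (forall j, measurable_fun (setT : set T3) (g1 j)) ->
  (forall j, measurable_fun (setT : set T3) (g2 j)) ->
  (H1sq (f1 \+ f2)%R (fun j => g1 j \+ g2 j)%R <= 2%:E * (H1sq f1 g1 + H1sq f2 g2))%E.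
Proof.
move=> mf1 mf2 mg1 mg2; rewrite /H1sq addeACA -big_split/= ge0_muleDr; last 2 first.
- by rewrite adde_ge0// sqint_ge0.
- by rewrite sume_ge0// => j _; rewrite adde_ge0// sqint_ge0.
apply: leeD; first exact: sqintD_le.
rewrite ge0_sume_distrr; last by move=> j _; rewrite adde_ge0// sqint_ge0.
by apply: lee_sum => j _; exact: sqintD_le.
Qed.

(** Either s is within distance |s|/2 of t, and then |s| <= 2 |t|, or s^2 is at
    most 4 (t - s)^2 and the truncation at c is used.  The last term allows L2
    convergence of t to s to be used against a fourth power. *)
Lemma trunc_le (s t c : R) : 0 <= c ->
  s ^+ 2 * Num.min (s ^+ 2) c <= 16 * (t ^+ 2) ^+ 2 + 4 * c * (t - s) ^+ 2.
Proof.
move=> c0; have s20 := sqr_ge0 s.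
have [h|h] := leP (s ^+ 2) (4 * (t - s) ^+ 2).
  apply: (@le_trans _ _ (c * (4 * (t - s) ^+ 2))).
    rewrite mulrC; apply: ler_pM => //; first by rewrite le_min s20.
    by rewrite ge_min lexx orbT.
  have := sqr_ge0 (t ^+ 2); lra.
have st : s ^+ 2 <= 4 * t ^+ 2.
  by rewrite leNgt; apply/negP => h2; have := sqr_ge0 (s - 2 * t); lra.
have : s ^+ 2 * Num.min (s ^+ 2) c <= (4 * t ^+ 2) * (4 * t ^+ 2).
  apply: ler_pM => //; first by rewrite le_min s20.
  by rewrite ge_min st.
have : 0 <= c * (t - s) ^+ 2 by rewrite mulr_ge0// sqr_ge0.
lra.
Qed.

(** Truncate f^4 to f^2 min(f^2, n): by [trunc_le] its integral is at most 16
    times that of F_m^4, which the Ladyzhenskaya inequality bounds, plus a term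
    tending to 0 with m for fixed n.  Then let n tend to infinity by monotone
    convergence.  The constant is 16 (truncation) times 4 (Ladyzhenskaya)
    times 4 (F_m = (F_m - f) + f, squared twice). *)
Lemma sqint_sqr_limit (F : nat -> R3 R -> R) f g : H10_lim F f g ->
  (sqint leb3 (fun x => f x ^+ 2)%R <= 256%:E * (H1sq f g * H1sq f g))%E.
Proof.
move=> FfG; have [FC mf mg cF cg] := FfG.
have [Hfin|] := boolP (H1sq f g \is a fin_num); last first.
  rewrite ge0_fin_numE ?H1sq_ge0// -leNgt leye_eq => /eqP ->.
  by rewrite mulyy gt0_muley// leey.
have mF m : measurable_fun (setT : set T3) (F m).
  by have [? _ _ _] := FC m; exact: continuous_measurable_R3.
have mpd m j : measurable_fun (setT : set T3) (pd j (F m)).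
  by have [_ ? _ _] := FC m; exact: continuous_measurable_R3.
set H := H1sq f g in Hfin *; have H0 : (0 <= H)%E by exact: H1sq_ge0.
pose h m := H1sq (F m \- f) (fun j => pd j (F m) \- g j).
have h0 m : (0 <= h m)%E by exact: H1sq_ge0.
have hc : h @ \oo --> 0%E := H1sq_cvg0 FfG.
pose tr n x := f x ^+ 2 * Num.min (f x ^+ 2) n%:R.
have mX (k : T3 -> R) : measurable_fun (setT : set T3) k ->
    measurable_fun (setT : set T3) (fun x => k x ^+ 2 : R).
  by move=> mk; exact: measurable_funX.
have mtr n : measurable_fun (setT : set T3) (tr n).
  apply: measurable_funM; first exact: mX.
  by apply: measurable_minr => //; exact: mX.
have tr0 n x : 0 <= tr n x by rewrite mulr_ge0 ?sqr_ge0// le_min sqr_ge0 ler0n.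
have tr_le n : (\int[leb3]_x (tr n x)%:E <= 256%:E * (H * H))%E.
  have step m : (\int[leb3]_x (tr n x)%:E <=
      256%:E * ((h m + H) * (h m + H)) + (4 * n%:R)%:E * sqint leb3 (F m \- f)%R)%E.
    apply: (@le_trans _ _ (16%:E * sqint leb3 (fun x => F m x ^+ 2)%R
        + (4 * n%:R)%:E * sqint leb3 (F m \- f)%R)%E).
      have m1 : measurable_fun (setT : set T3) (fun x => (F m x ^+ 2) ^+ 2).
        exact: (mX _ (mX _ (mF m))).
      have m2 : measurable_fun (setT : set T3) (fun x => (F m x - f x) ^+ 2).
        by apply: mX; exact: measurable_funB.
      rewrite /sqint -!ge0_integralZl_real//; last 2 first.
      - by move=> x; exact: sqr_ge0.
      - by move=> x; exact: sqr_ge0.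
      rewrite -ge0_integralD_real; last 4 first.
      - exact: measurable_funM.
      - exact: measurable_funM.
      - by move=> x; apply: mulr_ge0 => //; exact: sqr_ge0.
      - by move=> x; apply: mulr_ge0; [rewrite mulr_ge0|exact: sqr_ge0].
      apply: le_integral_real => //.
      - by apply: measurable_funD; exact: measurable_funM.
      - by move=> x; rewrite tr0 trunc_le.
    apply: leeD => //.
    apply: (le_trans (lee_wpmul2l _ (ladyzhenskaya (FC m)))) => //.
    have HF : (H1sq (F m) (fun j => pd j (F m)) <= 2%:E * (h m + H))%E.
      have := @H1sqD_le (F m \- f) f (fun j => pd j (F m) \- g j) g.
      rewrite (_ : (F m \- f) \+ f = F m); last by apply/funext => x /=; rewrite subrK.
      rewrite (_ : (fun j => (pd j (F m) \- g j) \+ g j) = (fun j => pd j (F m))); last first.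
        by apply/funext => j; apply/funext => x /=; rewrite subrK.
      apply=> //; first exact: measurable_funB.
      by move=> j; exact: measurable_funB.
    rewrite muleA -EFinM.
    apply: (le_trans (lee_wpmul2l _ (lee_pmul _ _ HF HF))) => //; do ?exact: H1sq_ge0.
    rewrite muleACA muleA -!EFinM (_ : 16 * 4 * (2 * 2) = 256 :> R)//.
    ring.
  have lc : (256%:E * ((h m + H) * (h m + H)) +
      (4 * n%:R)%:E * sqint leb3 (F m \- f)%R)%E @[m --> \oo]
      --> (256%:E * ((0 + H) * (0 + H)) + 0)%E.
    have hHc : (h m + H)%E @[m --> \oo] --> (0 + H)%E.
      by apply: cvgeD => //; exact: cvg_cst.
    have f0H : (0 + H)%E \is a fin_num by rewrite add0e.
    apply: cvgeD; last exact: cvgeZ0.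
    - by rewrite fin_num_adde_defl.
    - apply: cvgeZl => //; apply: cvgeM => //.
      by rewrite mule_def_fin.
  rewrite !add0e adde0 in lc.
  by apply: (cvge_ge _ lc); apply: nearW.
have := @cvg_monotone_convergence _ _ _ leb3 setT measurableT
  (fun n x => (tr n x)%:E).
have -> : (fun x => limn (fun n => (tr n x)%:E)) = (fun x => ((f x ^+ 2) ^+ 2)%:E).
  apply/funext => x; apply: lim_near_cst => //; near=> n.
  congr (_%:E); rewrite /tr (min_idPl _) -?expr2//.
  near: n; exact: nbhs_infty_ger.
move=> trc; apply: (cvge_le _ (trc _ _ _)).
- exact: nearW.
- by move=> n; apply/measurable_EFinP.
- by move=> n x _; rewrite lee_fin.
- move=> x _ a b ab; rewrite lee_fin /tr ler_wpM2l ?sqr_ge0//.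
  by rewrite le_min !ge_min lexx/= ler_nat ab orbT.
Unshelve. all: by end_near. Qed.

End limits.

(** * The integral of a derivative of a cubic expression *)

Section skew.
Variable R : realType.
Local Notation T3 := (measurableTypeR R * measurableTypeR R * measurableTypeR R)%type.
Local Notation leb3 := (@leb3 R).
Implicit Types (f a b : R3 R -> R) (g ga gb : 'I_3 -> R3 R -> R).

Lemma H10_lim_shift (F : nat -> R3 R -> R) f g k : H10_lim F f g ->
  H10_lim (fun m => F m \- F k) (f \- F k) (fun j => g j \- pd j (F k)).
Proof.
move=> [FC mf mg cF cg].
have mF : measurable_fun (setT : set T3) (F k).
  by have [? _ _ _] := FC k; exact: continuous_measurable_R3.
have mpd j : measurable_fun (setT : set T3) (pd j (F k)).
  by have [_ ? _ _] := FC k; exact: continuous_measurable_R3.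
split.
- by move=> m; exact: C1cB.
- exact: measurable_funB.
- by move=> j; exact: measurable_funB.
- rewrite (_ : (fun m => _) = (fun m => sqint leb3 (F m \- f)))//.
  by apply/funext => m; congr sqint; apply/funext => x /=; ring.
- move=> j; rewrite (_ : (fun m => _) = (fun m => sqint leb3 (pd j (F m) \- g j)))//.
  by apply/funext => m; congr sqint; apply/funext => x /=; rewrite pdB//; ring.
Qed.

(** Apply the inequality to f - F_m, which is itself the limit of the functions
    F_l - F_m as l grows, and whose H^1 norm tends to 0. *)
Lemma H10_lim_L4_cvg (F : nat -> R3 R -> R) f g : H10_lim F f g ->
  sqint leb3 (fun x => (F m x - f x) ^+ 2) @[m --> \oo] --> 0%E.
Proof.
move=> FfG; have hc := H1sq_cvg0 FfG.
pose h m := H1sq (F m \- f) (fun j => pd j (F m) \- g j).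
have hhc : (256%:E * (h m * h m))%E @[m --> \oo] --> 0%E.
  apply: cvgeZ0 => //; rewrite -[X in _ --> X](mule0 0%E).
  by apply: cvgeM => //; rewrite mule_def_fin.
apply: squeeze_cvge0 hhc.
move=> m; rewrite sqint_ge0/=.
have := sqint_sqr_limit (H10_lim_shift m FfG).
rewrite (_ : H1sq (f \- F m) _ = h m); last first.
  rewrite /h /H1sq sqint_sub_sym; congr (_ + _)%E.
  by apply: eq_bigr => j _; rewrite sqint_sub_sym.
apply: le_trans; rewrite le_eqVlt; apply/orP; left; apply/eqP.
by congr sqint; apply/funext => x /=; rewrite -sqrrN opprB.
Qed.

Lemma H10_lim_L4 (F : nat -> R3 R -> R) f g : H10_lim F f g ->
  (H1sq f g < +oo)%E -> (sqint leb3 (fun x => f x ^+ 2)%R < +oo)%E.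
Proof.
move=> FfG Hoo; apply: (le_lt_trans (sqint_sqr_limit FfG)).
have Hf : H1sq f g \is a fin_num by rewrite ge0_fin_numE// H1sq_ge0.
by rewrite ltey_eq !fin_numM.
Qed.

Lemma sqint_lty_H1sq f g : (sqint leb3 f < +oo)%E ->
  (forall j, sqint leb3 (g j) < +oo)%E -> (H1sq f g < +oo)%E.
Proof.
move=> foo goo; rewrite /H1sq lte_add_pinfty//.
by apply: lte_sum_pinfty => j _.
Qed.

(** The integral of d_j (a b^2) vanishes for the approximations; b^2 and 2 a b
    converge in L2 because a and b converge in L4, so the expanded derivative
    converges in L1. *)
Lemma integral_pd_mulsqr_eq0 (A B : nat -> R3 R -> R) a b ga gb j :
  H10_lim A a ga -> H10_lim B b gb ->
  (sqint leb3 a < +oo)%E -> (forall j, sqint leb3 (ga j) < +oo)%E ->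
  (sqint leb3 b < +oo)%E -> (forall j, sqint leb3 (gb j) < +oo)%E ->
  leb3.-integrable setT
    (fun x => (ga j x * (b x * b x) + gb j x * (2 * (a x * b x)))%:E) /\
  \int[leb3]_x (ga j x * (b x * b x) + gb j x * (2 * (a x * b x))) = 0.
Proof.
move=> hA hB aoo gaoo boo gboo.
have [AC ma mga _ cga] := hA; have [BC mb mgb _ cgb] := hB.
have cA := H10_lim_L4_cvg hA; have cB := H10_lim_L4_cvg hB.
have a4 := H10_lim_L4 hA (sqint_lty_H1sq aoo gaoo).
have b4 := H10_lim_L4 hB (sqint_lty_H1sq boo gboo).
have mA m : measurable_fun (setT : set T3) (A m).
  by have [? _ _ _] := AC m; exact: continuous_measurable_R3.
have mpA m : measurable_fun (setT : set T3) (pd j (A m)).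
  by have [_ ? _ _] := AC m; exact: continuous_measurable_R3.
have mB m : measurable_fun (setT : set T3) (B m).
  by have [? _ _ _] := BC m; exact: continuous_measurable_R3.
have mpB m : measurable_fun (setT : set T3) (pd j (B m)).
  by have [_ ? _ _] := BC m; exact: continuous_measurable_R3.
have mbb : measurable_fun (setT : set T3) (b \* b) by exact: measurable_funM.
have mab2 : measurable_fun (setT : set T3) (fun x => 2 * (a x * b x)).
  by apply: measurable_funM => //; exact: measurable_funM.
have mBB m : measurable_fun (setT : set T3) (B m \* B m) by exact: measurable_funM.
have mAB2 m : measurable_fun (setT : set T3) (fun x => 2 * (A m x * B m x)).
  by apply: measurable_funM => //; exact: measurable_funM.
have bb_oo := sqintM_lty mb mb b4 b4.
have sq2 (h : T3 -> R) : measurable_fun setT h ->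
    sqint leb3 (fun x => 2 * h x) = (4%:E * sqint leb3 h)%E.
  move=> mh; rewrite /sqint -ge0_integralZl_real//; last 2 first.
  - exact: measurable_funX.
  - by move=> x; exact: sqr_ge0.
  by apply: eq_integral => x _; congr (_%:E); ring.
have ab_oo : (sqint leb3 (fun x => 2 * (a x * b x))%R < +oo)%E.
  rewrite (sq2 (a \* b)); last exact: measurable_funM.
  have := sqintM_lty ma mb a4 b4.
  by rewrite -ge0_fin_numE ?sqint_ge0// => h; rewrite ltey_eq fin_numM.
have cBB := sqint_cvgM mB mB mb mb b4 b4 cB cB.
have cAB : sqint_cvg leb3 (fun m x => 2 * (A m x * B m x)) (fun x => 2 * (a x * b x)).
  have := cvgeZ0 (c := 4%:E) isT (sqint_cvgM mA mB ma mb a4 b4 cA cB).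
  rewrite /sqint_cvg; apply: cvg_trans; apply: near_eq_cvg; apply: nearW => m.
  rewrite -sq2; last by apply: measurable_funB; exact: measurable_funM.
  by congr sqint; apply/funext => x /=; ring.
have i1 := integrableM_sqint (mu := leb3) (mga j) mbb (gaoo j) bb_oo.
have i2 := integrableM_sqint (mu := leb3) (mgb j) mab2 (gboo j) ab_oo.
have c1 := L1_cvgM (mu := leb3) mpA mBB (mga j) mbb (gaoo j) bb_oo (cga j) cBB.
have c2 := L1_cvgM (mu := leb3) mpB mAB2 (mgb j) mab2 (gboo j) ab_oo (cgb j) cAB.
have mm1 m : measurable_fun (setT : set T3) (pd j (A m) \* (B m \* B m)).
  exact: measurable_funM.
have mm2 m : measurable_fun (setT : set T3)
    (pd j (B m) \* (fun x => 2 * (A m x * B m x))).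
  exact: measurable_funM.
have c := L1_cvgD mm1 mm2 (measurable_funM (mga j) mbb) (measurable_funM (mgb j) mab2) c1 c2.
have int : leb3.-integrable setT
    (fun x => (ga j x * (b x * b x) + gb j x * (2 * (a x * b x)))%:E).
  exact: (integrableD measurableT i1 i2).
split=> //; apply: (L1_cvg_Rintegral0 _ int c).
  by move=> m; exact: measurable_funD.
move=> m; rewrite -(Rintegral_pd_eq0 (phi := A m \* (B m \* B m)) j); last first.
  by apply: C1cM => //; exact: C1cM.
apply: eq_Rintegral => x _; rewrite pdM//; last exact: C1cM.
by rewrite pdM//=; ring.
Qed.

End skew.

(** * Square integrable functions and zero extensions of H^1_0 functions *)

Section real_integrals.
Context d (T : measurableType d) (R : realType).
Variable mu : {measure set T -> \bar R}.
Implicit Types f g h : T -> R.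

Definition square_integrable f :=
  measurable_fun setT f /\ (sqint mu f < +oo)%E.

Definition integrableR f := mu.-integrable setT (EFin \o f).

Lemma Lfun2_square_integrable f : f \in Lfun mu 2%:E -> square_integrable f.
Proof.
move=> f2; have /integrableP[_ foo] := Lfun2_integrable_sqr f2; split.
  by move: f2; rewrite inE => /andP[]; rewrite inE.
move: foo; congr (_ < _)%E; apply: eq_integral => x _ /=.
by rewrite ger0_norm// sqr_ge0.
Qed.

Lemma integrableR_mul f g : square_integrable f -> square_integrable g ->
  integrableR (f \* g).
Proof. by move=> [mf foo] [mg goo]; exact: integrableM_sqint. Qed.

Lemma integrableR_add f g : integrableR f -> integrableR g -> integrableR (f \+ g).
Proof. by move=> hf hg; exact: (integrableD measurableT hf hg). Qed.

Lemma integrableR_sub f g : integrableR f -> integrableR g -> integrableR (f \- g).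
Proof. by move=> hf hg; exact: (integrableB measurableT hf hg). Qed.

Lemma integrableR_scale c f : integrableR f -> integrableR (fun x => c * f x).
Proof. by move=> hf; exact: (integrableZl measurableT c hf). Qed.

Lemma Rintegral_sum n (h : 'I_n -> T -> R) : (forall i, integrableR (h i)) ->
  integrableR (fun x => \sum_(i < n) h i x) /\
  \int[mu]_x (\sum_(i < n) h i x) = \sum_(i < n) \int[mu]_x h i x.
Proof.
elim: n h => [|n IH] h hi.
  have -> : (fun x => \sum_(i < 0) h i x) = cst 0.
    by apply/funext => x; rewrite big_ord0.
  split; first exact: integrable0.
  by rewrite big_ord0 /Rintegral integral0.
have [i1 e1] := IH (fun i => h (widen_ord (leqnSn n) i)) (fun i => hi _).
have -> : (fun x => \sum_(i < n.+1) h i x) =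
    (fun x => \sum_(i < n) h (widen_ord (leqnSn n) i) x) \+ h ord_max.
  by apply/funext => x; rewrite big_ord_recr.
split; first exact: integrableR_add.
by rewrite big_ord_recr/= -e1 -RintegralD//; exact: hi.
Qed.

Lemma ae_eq_Rintegral f g : measurable_fun setT f -> measurable_fun setT g ->
  {ae mu, forall x, f x = g x} -> \int[mu]_x f x = \int[mu]_x g x.
Proof.
move=> mf mg fg; congr fine; apply: ae_eq_integral => //; try exact/measurable_EFinP.
by apply: filterS fg => x /= -> _.
Qed.

Lemma ae_imp (P Q : T -> Prop) : (forall x, P x -> Q x) ->
  {ae mu, forall x, P x} -> {ae mu, forall x, Q x}.
Proof. by move=> PQ; apply: filterS. Qed.

End real_integrals.

Section H10_limits.
Variable R : realType.
Local Notation T3 := (measurableTypeR R * measurableTypeR R * measurableTypeR R)%type.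
Local Notation leb3 := (@leb3 R).
Variable Om : set (R3 R).

(** The chosen weak derivative falls back to 0 only when none exists in L2. *)
Lemma wpd_L2 (f : R3 R -> R) j : H1 Om f -> L2 Om (wpd Om j f).
Proof. by case=> _ /(_ j) h; have [] := xgetPex (cst 0) h. Qed.

Lemma L2_cvg_sqint (F : nat -> R3 R -> R) (f : R3 R -> R) :
  (forall m x, ~ Om x -> F m x = 0) -> L2_cvg Om F f ->
  sqint leb3 (F m \- f \_ Om) @[m --> \oo] --> 0%E.
Proof.
move=> F0 Ff; rewrite /L2_cvg in Ff.
have := cvgeM _ Ff Ff; rewrite mule0 mule_def_fin// => /(_ _ isT).
apply: cvg_trans; apply: near_eq_cvg; apply: nearW => m /=.
rewrite sqint_Lnorm poweR12_sqrt ?sqint_ge0// -expe2 sqr_sqrte ?sqint_ge0//.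
congr sqint; apply/funext => x /=; rewrite !patchE.
by case: ifPn => // /negP; rewrite inE => /F0 ->; rewrite subr0.
Qed.

Lemma H10_H10_lim (f : R3 R -> R) : H10 Om f ->
  exists F, H10_lim F (f \_ Om) (fun j => wpd Om j f \_ Om).
Proof.
move=> [H1f [F [FT Ff Fg]]]; exists F.
have [L2f _] := H1f; split.
- by move=> m; exact: (test_fun_C1c (FT m)).
- by have [] := Lfun2_square_integrable L2f.
- by move=> j; have [] := Lfun2_square_integrable (wpd_L2 j H1f).
- by apply: L2_cvg_sqint => // m x nx; have [] := test_fun_out (FT m) nx.
- move=> j; apply: (@L2_cvg_sqint (fun m => pd j (F m))) => // m x nx.
  by have [_] := test_fun_out (FT m) nx.
Qed.

End H10_limits.

(** * The energy estimate *)

Section energy_step.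
Variable R : realType.
Local Notation T3 := (measurableTypeR R * measurableTypeR R * measurableTypeR R)%type.
Local Notation leb3 := (@leb3 R).
Variable Om : set (R3 R).
Local Notation sq := (square_integrable leb3).
Local Notation RI := (integrableR leb3).

Lemma restrict_in (h : R3 R -> R) x : Om x -> (h \_ Om) x = h x.
Proof. by move=> Ox; rewrite patchE mem_set. Qed.

Lemma restrict_out (h : R3 R -> R) x : ~ Om x -> (h \_ Om) x = 0.
Proof. by move=> Ox; rewrite patchE memNset. Qed.

Lemma Rintegral_restrict (h k : R3 R -> R) : (forall x, Om x -> h x = k x) ->
  (forall x, ~ Om x -> k x = 0) -> \int[leb3]_(x in Om) h x = \int[leb3]_x k x.
Proof.
move=> hk k0; rewrite Rintegral_mkcond; apply: eq_Rintegral => x _.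
have [Ox|nOx] := pselect (Om x); first by rewrite restrict_in// hk.
by rewrite restrict_out// k0.
Qed.

Definition nsq (h : R3 R -> R) : R := \int[leb3]_x ((h \_ Om) x) ^+ 2.

Lemma nsq_ge0 h : 0 <= nsq h.
Proof. by apply: Rintegral_ge0 => x _; exact: sqr_ge0. Qed.

Lemma RI_sqr h : sq h -> RI (fun x => h x ^+ 2).
Proof. by move=> hh; have := integrableR_mul hh hh. Qed.

Lemma Rintegral_energy (e : R) (U : 'I_3 -> R3 R -> R) (P : R3 R -> R) :
  (forall i, sq (U i)) -> sq P ->
  RI (fun x => \sum_(i < 3) U i x ^+ 2 + e * P x ^+ 2) /\
  \int[leb3]_x (\sum_(i < 3) U i x ^+ 2 + e * P x ^+ 2) =
    \sum_(i < 3) \int[leb3]_x (U i x ^+ 2) + e * \int[leb3]_x (P x ^+ 2).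
Proof.
move=> hU hP.
have [i1 e1] := Rintegral_sum (fun i => RI_sqr (hU i)).
have i2 := integrableR_scale e (RI_sqr hP); split; first exact: integrableR_add.
by rewrite RintegralD// e1 RintegralZl//; exact: RI_sqr.
Qed.

Lemma energyE (e : R) (u : 'I_3 -> R3 R -> R) (p : R3 R -> R) :
  (forall i, L2 Om (u i)) -> L2 Om p ->
  energy Om e u p = 2^-1 * (\sum_(i < 3) nsq (u i) + e * nsq p).
Proof.
move=> hu hp; rewrite /energy; congr (_ * _).
have [_ <-] := Rintegral_energy e (fun i => Lfun2_square_integrable (hu i))
  (Lfun2_square_integrable hp).
apply: Rintegral_restrict => x Ox.
  by rewrite restrict_in//; congr (_ + _); apply: eq_bigr => i _; rewrite restrict_in.
by rewrite big1 => [|i _]; rewrite restrict_out// expr0n ?mulr0 ?addr0.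
Qed.

Lemma nsq_ae_eq (h k : R3 R -> R) : L2 Om h -> L2 Om k ->
  {ae leb3, forall x, Om x -> h x = k x} -> nsq h = nsq k.
Proof.
move=> /Lfun2_square_integrable[mh _] /Lfun2_square_integrable[mk _] hk.
apply: ae_eq_Rintegral; [exact: measurable_funX|exact: measurable_funX|].
apply: (ae_imp (mu := leb3) _ hk) => x {}hk; have [Ox|nOx] := pselect (Om x).
  by rewrite !restrict_in// hk.
by rewrite !restrict_out.
Qed.

(** The integrand equals half the sum over i and j of
    (d_j u_j) u_i^2 + 2 u_j u_i (d_j u_i), the expansion of d_j (u_j u_i^2). *)
Lemma integral_convection (u : 'I_3 -> R3 R -> R) : (forall i, H10 Om (u i)) ->
  \int[leb3]_(x in Om) (\sum_(i < 3) convection Om u i x * u i x) = 0.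
Proof.
move=> hu; pose U i := u i \_ Om; pose G i j := wpd Om j (u i) \_ Om.
have sU i : sq (U i) by have [[? _] _] := hu i; exact: Lfun2_square_integrable.
have sG i j : sq (G i j).
  by have [? _] := hu i; exact/Lfun2_square_integrable/wpd_L2.
pose W i j x := G j j x * (U i x * U i x) + G i j x * (2 * (U j x * U i x)).
have hW i j : RI (W i j) /\ \int[leb3]_x W i j x = 0.
  have [A hA] := H10_H10_lim (hu j); have [B hB] := H10_H10_lim (hu i).
  apply: (integral_pd_mulsqr_eq0 j hA hB); [exact: (sU j).2|move=> l; exact: (sG j l).2|
    exact: (sU i).2|move=> l; exact: (sG i l).2].
have hWi i := Rintegral_sum (fun j => (hW i j).1).
have [Wint W0] := Rintegral_sum (fun i => (hWi i).1).
transitivity (\int[leb3]_x (2^-1 * \sum_(i < 3) \sum_(j < 3) W i j x)).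
  apply: Rintegral_restrict => x Ox.
    rewrite mulr_sumr; apply: eq_bigr => i _.
    rewrite /convection /wdiv mulrDl mulr_suml !mulr_sumr !mulr_suml -big_split/=.
    by apply: eq_bigr => j _; rewrite /W /U /G !restrict_in//; field.
  rewrite big1 ?mulr0// => i _; rewrite big1// => j _.
  by rewrite /W /U /G !restrict_out// !mul0r addr0.
rewrite RintegralZl// W0 big1 ?mulr0// => i _.
by rewrite (hWi i).2 big1// => j _; exact: (hW i j).2.
Qed.

(** Testing with u' bounds the integral of k W, where
    k W = (u' - u) u' + e (p' - p) p', by 0; pointwise 2 k W is at least
    u'^2 + e p'^2 - (u^2 + e p^2). *)
Lemma energy_step (nu k e : R) (u u' : 'I_3 -> R3 R -> R) (p p' : R3 R -> R)
    (f : 'I_3 -> R3 R -> R) :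
  0 < nu -> 0 < k -> 0 < e ->
  (forall i, L2 Om (u i)) -> (forall i, H10 Om (u' i)) ->
  L2 Om p -> L2 Om p' -> (forall i, L2 Om (f i)) ->
  weak_momentum Om nu k u u' p' f ->
  {ae leb3, forall x, Om x -> e * ((p' x - p x) / k) + wdiv Om u' x = 0} ->
  (forall i, {ae leb3, forall x, Om x -> f i x = 0}) ->
  \sum_(i < 3) nsq (u' i) + e * nsq p' <= \sum_(i < 3) nsq (u i) + e * nsq p.
Proof.
move=> nu0 k0 e0 hu hu' hp hp' hf mom comp f0.
pose U i := u' i \_ Om; pose V i := u i \_ Om; pose F i := f i \_ Om.
pose P := p' \_ Om; pose Q := p \_ Om; pose G i j := wpd Om j (u' i) \_ Om.
have sU i : sq (U i) by have [[? _] _] := hu' i; exact: Lfun2_square_integrable.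
have sV i : sq (V i) := Lfun2_square_integrable (hu i).
have sF i : sq (F i) := Lfun2_square_integrable (hf i).
have sP : sq P := Lfun2_square_integrable hp'.
have sQ : sq Q := Lfun2_square_integrable hp.
have sG i j : sq (G i j).
  by have [? _] := hu' i; exact/Lfun2_square_integrable/wpd_L2.
have := mom u' hu'; rewrite integral_convection// addr0.
have -> : \int[leb3]_(x in Om) (\sum_(i < 3) f i x * u' i x) = 0.
  have iFU i : RI (F i \* U i) by exact: integrableR_mul.
  transitivity (\int[leb3]_x \sum_(i < 3) (F i \* U i) x).
    apply: Rintegral_restrict => x Ox.
      by apply: eq_bigr => i _; rewrite /= /F /U !restrict_in.
    by rewrite big1// => i _; rewrite /= /F restrict_out// mul0r.
  rewrite (Rintegral_sum iFU).2 big1// => i _.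
  rewrite -[RHS](_ : \int[leb3]_x (0 : R) = 0); last by rewrite /Rintegral integral0.
  apply: ae_eq_Rintegral => //.
    by apply: measurable_funM; [exact: (sF i).1|exact: (sU i).1].
  apply: (ae_imp (mu := leb3) _ (f0 i)) => x fx /=; have [Ox|nOx] := pselect (Om x).
    by rewrite /F restrict_in// fx// mul0r.
  by rewrite /F restrict_out// mul0r.
set I3 := \int[leb3]_(x in Om) (\sum_(i < 3) \sum_(j < 3) _).
have I30 : 0 <= nu * I3.
  rewrite mulr_ge0//; first exact: ltW.
  apply: Rintegral_ge0 => x _; rewrite sumr_ge0// => i _.
  by rewrite sumr_ge0// => j _; rewrite -expr2 sqr_ge0.
pose W1 x := \sum_(i < 3) k^-1 * (U i x * U i x - V i x * U i x).
pose W2 x := e / k * (P x * P x - P x * Q x).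
have iW1 : RI W1.
  apply: (Rintegral_sum _).1 => i; apply: integrableR_scale.
  by apply: integrableR_sub; exact: integrableR_mul.
have iW2 : RI W2.
  by apply: integrableR_scale; apply: integrableR_sub; exact: integrableR_mul.
have -> : \int[leb3]_(x in Om) (\sum_(i < 3) (u' i x - u i x) / k * u' i x)
    = \int[leb3]_x W1 x.
  apply: Rintegral_restrict => x Ox.
    apply: eq_bigr => i _; rewrite /U /V !restrict_in//.
    by field; rewrite gt_eqF.
  by rewrite /W1 big1// => i _; rewrite /U /V !restrict_out// !mul0r subrr mulr0.
have -> : \int[leb3]_(x in Om) (p' x * wdiv Om u' x) = - \int[leb3]_x W2 x.
  transitivity (\int[leb3]_x (P x * \sum_(j < 3) G j j x)).
    apply: Rintegral_restrict => x Ox.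
      rewrite /P restrict_in//; congr (_ * _); apply: eq_bigr => j _.
      by rewrite /G restrict_in.
    by rewrite /P restrict_out// mul0r.
  rewrite -mulN1r -RintegralZl//; apply: ae_eq_Rintegral.
  - apply: measurable_funM; first exact: sP.1.
    by apply: measurable_sum => j; exact: (sG j j).1.
  - by apply: measurable_funM => //; have /measurable_EFinP := measurable_int _ iW2.
  - apply: (ae_imp (mu := leb3) _ comp) => x cx; have [Ox|nOx] := pselect (Om x).
      have -> : \sum_(j < 3) G j j x = wdiv Om u' x.
        by apply: eq_bigr => j _; rewrite /G restrict_in.
      rewrite /W2 /P /Q !restrict_in//.
      have /eqP := cx Ox; rewrite addrC addr_eq0 => /eqP ->.
      by field; rewrite gt_eqF.
    by rewrite /W2 /P /Q !restrict_out// !mul0r subrr !mulr0.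
rewrite opprK -RintegralD// => W0.
have {}W0 : \int[leb3]_x (W1 x + W2 x) <= 0 by lra.
have iW := integrableR_add iW1 iW2.
have [iY <-] := Rintegral_energy e sU sP.
have [iZ <-] := Rintegral_energy e sV sQ.
rewrite -subr_le0 -RintegralB//.
(* the factor 2 k clears 1/k and the 1/2 in (a - b) a >= (a^2 - b^2)/2 *)
apply: (@le_trans _ _ (2 * k * \int[leb3]_x (W1 x + W2 x))); last first.
  by rewrite mulr_ge0_le0// mulr_ge0// ltW.
rewrite -RintegralZl//; apply: le_Rintegral => //.
- exact: integrableR_sub.
- exact: integrableR_scale.
move=> x _; rewrite /W1 /W2 mulrDr.
have -> : 2 * k * (e / k * (P x * P x - P x * Q x)) = 2 * e * (P x * P x - P x * Q x).
  by field; rewrite gt_eqF.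
rewrite mulr_sumr opprD addrACA -sumrB; apply: lerD.
  apply: ler_sum => i _.
  rewrite mulrA -(mulrA 2) divff ?gt_eqF// mulr1.
  by have := sqr_ge0 (U i x - V i x); lra.
have := sqr_ge0 (P x - Q x) => h.
by have := mulr_ge0 (ltW e0) h; lra.
Qed.

End energy_step.

Theorem theorem2p1 (R : realType) (Om : set (R3 R))
  (hOm : (open Om /\ bounded_set Om) \/ Om = setT)
  (nu : R) (hnu : 0 < nu)
  (k eps : nat -> R) (hk : forall n, 0 < k n) (heps : forall n, 0 < eps n)
  (f : nat -> 'I_3 -> R3 R -> R) (hf : forall n i, L2 Om (f n i))
  (u0 : 'I_3 -> R3 R -> R) (p0 : R3 R -> R)
  (hu0 : forall i, L2 Om (u0 i)) (hp0 : L2 Om p0)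
  (u : nat -> 'I_3 -> R3 R -> R) (p : nat -> R3 R -> R)
  (hu_init : forall i, L2 Om (u 0%N i))
  (hu : forall n i, (1 <= n)%N -> H10 Om (u n i))
  (hp : forall n, L2 Om (p n))
  (momentum : forall n,
    weak_momentum Om nu (k n.+1) (u n) (u n.+1) (p n.+1) (f n.+1))
  (compressibility : forall n, {ae @leb3 R, forall x, Om x ->
    eps n.+1 * ((p n.+1 x - p n x) / k n.+1) + wdiv Om (u n.+1) x = 0})
  (init_u : forall i, {ae @leb3 R, forall x, Om x -> u 0%N i x = u0 i x})
  (init_p : {ae @leb3 R, forall x, Om x -> p 0%N x = p0 x})
  (f_eq0 : forall n i, {ae @leb3 R, forall x, Om x -> f n i x = 0})
  (beta : R)
  (hbeta : forall n, `|(eps n.+1 - eps n) / k n| <= beta * eps n) :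
  forall n : nat, (1 <= n)%N ->
    energy Om (eps n) (u n) (p n)
      <= (\prod_(0 <= j < n) (1 + k j * beta)) * energy Om (eps 0%N) u0 p0
    /\ (\prod_(0 <= j < n) (1 + k j * beta)) * energy Om (eps 0%N) u0 p0
      <= expR (beta * \sum_(0 <= j < n) k j) * energy Om (eps 0%N) u0 p0.
Proof.
have uL2 n i : L2 Om (u n i).
  by case: n => [|n]; [exact: hu_init|have [[]] := hu n.+1 i isT].
have beta0 : 0 <= beta.
  by rewrite -(pmulr_lge0 _ (heps 0%N)); exact: le_trans (hbeta 0%N).
have kb0 j : 0 <= k j * beta by rewrite mulr_ge0// ltW.
have E0 : energy Om (eps 0%N) (u 0%N) (p 0%N) = energy Om (eps 0%N) u0 p0.
  rewrite !energyE//; congr (_ * (_ + _ * _)).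
    by apply: eq_bigr => i _; exact: nsq_ae_eq.
  exact: nsq_ae_eq.
have E_ge0 : 0 <= energy Om (eps 0%N) u0 p0.
  rewrite energyE// mulr_ge0// addr_ge0//.
    by apply: sumr_ge0 => i _; exact: nsq_ge0.
  by rewrite mulr_ge0 ?nsq_ge0// ltW.
have eps_le n : eps n.+1 <= (1 + k n * beta) * eps n.
  have := le_trans (ler_norm _) (hbeta n).
  by rewrite ler_pdivrMr//; lra.
have step n : energy Om (eps n.+1) (u n.+1) (p n.+1)
    <= (1 + k n * beta) * energy Om (eps n) (u n) (p n).
  rewrite !energyE// mulrCA ler_pM2l//.
  have := energy_step hnu (hk n.+1) (heps n.+1) (uL2 n)
    (fun i => hu n.+1 i isT) (hp n) (hp n.+1) (hf n.+1) (momentum n)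
    (compressibility n) (f_eq0 n.+1).
  move=> /le_trans; apply; rewrite mulrDr; apply: lerD.
    apply: ler_peMl; last by rewrite lerDl.
    by apply: sumr_ge0 => i _; exact: nsq_ge0.
  by rewrite mulrA ler_wpM2r// nsq_ge0.
move=> n _; split.
  elim: n => [|n IH]; first by rewrite big_geq// mul1r E0.
  apply: (le_trans (step n)).
  rewrite big_nat_recr//= mulrAC [leRHS]mulrC.
  by apply: ler_wpM2l => //; exact: addr_ge0.
rewrite ler_wpM2r// mulr_sumr expR_sum; apply: ler_prod => j _.
by rewrite addr_ge0//= mulrC expR_ge1Dx.
Qed.
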